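(* Let $G$ be a finite abelian group and let $N\subset M$ be the $3^G$ subfactor, with inclusion $\iota$, constructed from a C$^*$-generalized Haagerup category $\mathcal{C}$ with $G$ whose numerical data satisfy $A_0(h,0)=\delta_{h,0}-\frac1{d-1}$ for all $h\in G$. In the irreducible decomposition $$[\overline{\iota}\kappa]=\sum_{z\in G_2}[\hat\rho\beta_z]+\sum_{g\in J_0}[\pi_g]+\sum_{j\in J_1}n_j[\sigma_j],$$ where the $\sigma_j$ are mutually inequivalent irreducibles, inequivalent to all $\hat\rho\beta_z$ and $\pi_g$, and $n_j\ge1$, one has $n_j=1$ for every $j\in J_1$.
   Context: Let $G$ be a finite abelian group (additive), $n=|G|$, $d=\frac{n+\sqrt{n^2+4}}2$, $G_2=\{g\in G:2g=0\}$. $M$ is the hyperfinite type III$_1$ factor; for unital homomorphisms $\sigma,\sigma'$ into $M$, $(\sigma,\sigma')=\{T\in M:T\sigma(x)=\sigma'(x)T\ \forall x\}$; $[\cdot]$ denotes unitary equivalence classes, $\overline{\sigma}$ the conjugate. $\mathcal C\subset\operatorname{End}(M)$ is a C$^*$-generalized Haagerup category with $G$: there are $\rho\in\operatorname{End}(M)$ irreducible self-conjugate and an (outer) action $\alpha:G\to\operatorname{Aut}(M)$ with $\alpha_g\rho=\rho\alpha_{-g}$, simple classes exactly the distinct classes $[\alpha_g],[\alpha_g\rho]$, fusion rule $[\rho]^2=[\mathrm{id}]+\sum_g[\alpha_g\rho]$, and $\alpha|_{G_2}$ trivial on $(\rho,\rho^2)$ (a standard lifting). Let $S\in(\mathrm{id},\rho^2)$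 and $T_g\in(\alpha_g\rho,\rho^2)$ be isometries with $\sqrt d\,T_g^*\rho(S)=T_g$ and $\alpha_h(T_0)=T_{2h}$; the numerical data are defined by $\alpha_h(T_g)=\epsilon_h(g)T_{g+2h}$, $\alpha_g\rho(T_g)=\eta_gT_gSS^*+\frac{\overline{\eta_g}}{\sqrt d}ST_g^*+\sum_{h,k}A_g(h,k)T_{g+h}T_{g+h+k}T_{g+k}^*$. The subfactor. Assume $A_0(h,0)=\delta_{h,0}-\frac1{d-1}$. Choose isometries $V_0,V_1$ in the fixed point algebra $M^G$ of $\alpha$ with $V_0V_0^*+V_1V_1^*=1$, put $\gamma(x)=V_0xV_0^*+V_1\rho(x)V_1^*$ and $W=\frac1{\sqrt{d+1}}V_0+\frac1{\sqrt{d+1}}V_1\rho(V_0)V_1^*+\sqrt{\frac d{d+1}}V_1\rho(V_1)SV_0^*+\sqrt{\frac{d-1}{d+1}}V_1\rho(V_1)T_0V_1^*$. Then $(\gamma,V_0,W)$ is a $Q$-system and $N=\{x\in M: Wx=\gamma(x)W,\ Wx^*=\gamma(x^* )W\}$ is the corresponding $3^G$ subfactor; $\iota:N\hookrightarrow M$ is the inclusion, and $\overline\iota$ is $\gamma$ regarded as a map $M\to N$, so $[\iota\overline\iota]=[\mathrm{id}]+[\rho]$. Objects. $\kappa:N\to M$ is the irreducible homomorphism with $[\rho\iota]=[\iota]+[\kappa]$. $\hat\rho\in\operatorname{End}(N)$ is the irreducible endomorphism with $[\overline\iota\iota]=[\mathrm{id}]+[\hat\rho]$. For $z\in G_2$,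 $\alpha_z$ preserves $N$ and $\beta_z=\alpha_z|_N$. $J_0\subset G\setminus G_2$ is a set of representatives for the equivalence relation $g\sim h\iff g=\pm h$ on $G\setminus G_2$, and $\pi_g=\overline\iota\alpha_g\iota$ for $g\in J_0$ (these are irreducible). Each $\hat\rho\beta_z$ and each $\pi_g$ occurs exactly once in $\overline\iota\kappa$; $\{\sigma_j\}_{j\in J_1}$ are the remaining irreducible components and $n_j$ their multiplicities. *)

(* Defs.v *)
From HB Require Import structures.
From mathcomp Require Import all_boot all_order all_algebra.
From mathcomp Require Import complex.
From mathcomp Require Import all_classical all_reals all_analysis.

Set Implicit Arguments.
Unset Strict Implicit.
Unset Printing Implicit Defensive.

Import Order.TTheory GRing.Theory Num.Theory.
Import numFieldNormedType.Exports.

Local Open Scope classical_set_scope.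
Local Open Scope complex_scope.
Local Open Scope ring_scope.

HB.mixin Record isStarAlgebra (R : rcfType) M of GRing.Algebra R[i] M := {
  star : M -> M;
  starK : involutive star;
  starD : {morph star : x y / x + y};
  starZ : forall (a : R[i]) (x : M), star (a *: x) = Num.conj a *: star x;
  starM : forall x y : M, star (x * y) = star y * star x }.

#[short(type="starAlgType")]
HB.structure Definition StarAlgebra (R : rcfType) :=
  { M of GRing.Algebra R[i] M & isStarAlgebra R M }.

Section Hilbert.
Context {R : realType} {H : completeNormedModType R[i]}.

Definition bounded_operators : set (H -> H) :=
  [set T | linear T /\ continuous T].

Definition commutant (A : set (H -> H)) : set (H -> H) :=
  [set T | bounded_operators T /\ forall a, A a -> T \o a = a \o T].

Definition separable_space : Prop := exists2 D : set H, countable D & dense D.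

(* The norm of [H] comes from the inner product [ip] (linear on the left). *)
Definition hilbert_norm (ip : {dot H for Num.conj}) : Prop :=
  forall x : H, `|x| ^+ 2 = ip x x.

Context {M : starAlgType R}.
Variables (ip : {dot H for Num.conj}) (pi : M -> H -> H).

Definition star_representation : Prop :=
  [/\ forall a, bounded_operators (pi a),
      linear pi,
      pi 1 = idfun,
      forall a b, pi (a * b) = pi a \o pi b &
      forall a x y, ip (pi a x) y = ip x (pi (star a) y)].

Definition cyclic_vector (xi : H) : Prop := dense (range (fun a => pi a xi)).

Definition separating_vector (xi : H) : Prop :=
  forall a, pi a xi = 0 -> a = 0.

(* Graph of the Tomita operator, the closure of the antilinear map
   [a xi |-> a^* xi]. *)
Definition tomita (xi : H) : set (H * H) :=
  closure (range (fun a => (pi a xi, pi (star a) xi))).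

(* Graph of its adjoint; as the map is antilinear, [S^* y = w] means
   [<S x, y> = <w, x>]. *)
Definition tomita_adjoint (xi : H) : set (H * H) :=
  [set yw | forall a, ip (pi (star a) xi) yw.1 = ip yw.2 (pi a xi)].

(* Graph of the modular operator [Delta = S^* S]. *)
Definition modular (xi : H) : set (H * H) :=
  [set uv | exists w, tomita xi (uv.1, w) /\ tomita_adjoint xi (w, uv.2)].

(* Spectrum of a closed operator given by its graph: a bijective closed
   operator has a bounded inverse by the closed graph theorem. *)
Definition spectrum (D : set (H * H)) : set R[i] :=
  [set l | ~ forall v, exists! u, D (u, v + l *: u)].

(* Connes' invariant S(M), for a type III factor acting standardly on a
   separable space: every faithful normal state is then the vector state of a
   cyclic and separating vector. *)
Definition connes_S : set R[i] :=
  [set l | forall xi, cyclic_vector xi -> separating_vector xi ->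
             spectrum (modular xi) l].

End Hilbert.

Section Factor.
Context {R : realType}.
Variable M : starAlgType R.

Definition is_factor : Prop :=
  forall c : M, (forall x, c * x = x * c) -> exists a : R[i], c = a *: 1.

Definition typeIII : Prop :=
  forall p : M, star p = p -> p * p = p -> p != 0 ->
    exists v : M, let q := v * star v in
      [/\ star v * v = p, p * q = q & q != p].

Definition findim_star_subalgebra (F : set M) : Prop :=
  [/\ F 1,
      forall (a : R[i]) x y, F x -> F y -> F (a *: x + y),
      forall x y, F x -> F y -> F (x * y),
      forall x, F x -> F (star x) &
      exists m (e : 'I_m -> M), forall x, F x ->
        exists c : 'I_m -> R[i], x = \sum_i c i *: e i].

(* [pi] realises [M] as a von Neumann algebra. *)
Definition von_neumann (H : completeNormedModType R[i]) (pi : M -> H -> H) :=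
  injective pi /\ commutant (commutant (range pi)) = range pi.

Definition hyperfinite (H : completeNormedModType R[i]) (pi : M -> H -> H) :=
  exists F : nat -> set M,
    [/\ forall k, findim_star_subalgebra (F k),
        forall k, F k `<=` F k.+1 &
        commutant (commutant (pi @` \bigcup_k F k)) = range pi].

Definition hyperfinite_III1_factor : Prop :=
  [/\ is_factor, typeIII &
    exists (H : completeNormedModType R[i]) (ip : {dot H for Num.conj})
           (pi : M -> H -> H),
      [/\ separable_space (H := H) /\ hilbert_norm ip,
          star_representation ip pi /\ von_neumann pi,
          exists2 xi, cyclic_vector pi xi & separating_vector pi xi,
          hyperfinite pi &
          connes_S ip pi = [set l | 0 <= l]]].

End Factor.

(* [M] is the ambient algebra and [A], [B] are unital *-subalgebras of it. A
   homomorphism [A -> B] is a map [M -> M] of which only the values on [A]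
   matter: every notion below only evaluates it on [A]. Normality is automatic
   between properly infinite algebras with separable predual. *)
Section Sectors.
Context {R : rcfType} {M : starAlgType R}.
Implicit Types (A B : set M) (s t : M -> M).

Definition unital_hom A B s : Prop :=
  [/\ forall x, A x -> B (s x),
      s 1 = 1,
      forall (a : R[i]) x y, A x -> A y -> s (a *: x + y) = a *: s x + s y,
      forall x y, A x -> A y -> s (x * y) = s x * s y &
      forall x, A x -> s (star x) = star (s x)].

Definition intertwiners A B s t : set M :=
  [set T | B T /\ forall x, A x -> T * s x = t x * T].

Definition is_isometry (V : M) : Prop := star V * V = 1.

Definition unitary_element (U : M) : Prop := star U * U = 1 /\ U * star U = 1.

(* [s] = [t] *)
Definition equivalent A B s t : Prop :=
  exists2 U, intertwiners A B s t U & unitary_element U.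

Definition irreducible A B s : Prop :=
  unital_hom A B s /\
  forall T, intertwiners A B s s T -> exists a : R[i], T = a *: 1.

(* [s] = \sum_i [f i] *)
Definition direct_sum A B s (I : finType) (f : I -> M -> M) : Prop :=
  exists V : I -> M,
    [/\ forall i, B (V i),
        forall i j, star (V i) * V j = (i == j)%:R,
        \sum_i V i * star (V i) = 1 &
        forall x, A x -> s x = \sum_i V i * f i x * star (V i)].

(* [s] = [t1] + [t2] *)
Definition direct_sum2 A B s t1 t2 : Prop :=
  direct_sum A B s (fun b : bool => if b then t2 else t1).

(* [sbar : B -> A] is a conjugate of [s : A -> B]: the conjugate equations. *)
Definition conjugate_hom A B s sbar : Prop :=
  exists r rbar,
    [/\ intertwiners A A id (sbar \o s) r,
        intertwiners B B id (s \o sbar) rbar,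
        star rbar * s r = 1 & star r * sbar rbar = 1].

End Sectors.

Section Haagerup.
Context {R : rcfType} {M : starAlgType R} {G : finZmodType}.
Implicit Types (rho : M -> M) (alpha : G -> M -> M).

Definition two_torsion : pred G := fun z => z + z == 0.

Definition haagerup_dim : R :=
  (#|G|%:R + Num.sqrt (#|G|%:R ^+ 2 + 4)) / 2.
Local Notation d := haagerup_dim.

Definition group_action alpha : Prop :=
  [/\ forall g, unital_hom setT setT (alpha g),
      alpha 0 = id &
      forall g h, alpha (g + h) = alpha g \o alpha h].

Definition haagerup_simple rho alpha (i : G * bool) : M -> M :=
  if i.2 then alpha i.1 \o rho else alpha i.1.

(* [C] is the full replete subcategory of [End M] with the given simple
   objects; outerness of the action is part of [gH_distinct]. *)
Record generalized_haagerup (C : set (M -> M)) rho alpha : Prop := {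
  gH_irreducible : irreducible setT setT rho;
  gH_selfconj : conjugate_hom setT setT rho rho;
  gH_action : group_action alpha;
  gH_commute : forall g, alpha g \o rho = rho \o alpha (- g);
  gH_simple : forall i, irreducible setT setT (haagerup_simple rho alpha i);
  gH_distinct : forall i j,
    equivalent setT setT (haagerup_simple rho alpha i)
                         (haagerup_simple rho alpha j) -> i = j;
  gH_objects : forall s, C s <-> unital_hom setT setT s /\
    exists (I : finType) (f : I -> G * bool),
      direct_sum setT setT s (fun k => haagerup_simple rho alpha (f k));
  gH_fusion : direct_sum setT setT (rho \o rho)
    (fun o : option G => if o is Some g then alpha g \o rho else id);
  gH_standard : forall z, two_torsion z -> forall T,
    intertwiners setT setT rho (rho \o rho) T -> alpha z T = T }.

Record haagerup_data rho alpha (S : M) (T : G -> M)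
    (eps : G -> G -> R[i]) (eta : G -> R[i]) (A : G -> G -> G -> R[i])
    : Prop := {
  hd_S : intertwiners setT setT id (rho \o rho) S /\ is_isometry S;
  hd_T : forall g,
    intertwiners setT setT (alpha g \o rho) (rho \o rho) (T g) /\
    is_isometry (T g);
  hd_frobenius : forall g, (Num.sqrt d)%:C *: (star (T g) * rho S) = T g;
  hd_T0 : forall h, alpha h (T 0) = T (h *+ 2);
  hd_eps : forall h g, alpha h (T g) = eps h g *: T (g + h *+ 2);
  hd_A : forall g, alpha g (rho (T g)) =
    eta g *: (T g * S * star S)
    + (Num.conj (eta g) / (Num.sqrt d)%:C) *: (S * star (T g))
    + \sum_(h : G) \sum_(k : G)
        A g h k *: (T (g + h) * T (g + h + k) * star (T (g + k))) }.

Definition fixed_points alpha : set M := [set x | forall g, alpha g x = x].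

Definition qsystem_hom rho (V0 V1 : M) : M -> M :=
  fun x => V0 * x * star V0 + V1 * rho x * star V1.

Definition qsystem_isometry rho (S T0 V0 V1 : M) : M :=
  ((Num.sqrt (d + 1))^-1)%:C *: V0
  + ((Num.sqrt (d + 1))^-1)%:C *: (V1 * rho V0 * star V1)
  + (Num.sqrt (d / (d + 1)))%:C *: (V1 * rho V1 * S * star V0)
  + (Num.sqrt ((d - 1) / (d + 1)))%:C *: (V1 * rho V1 * T0 * star V1).

Definition qsystem_subalgebra (gamma : M -> M) (W : M) : set M :=
  [set x | W * x = gamma x * W /\ W * star x = gamma (star x) * W].

(* Representatives for g ~ h <-> g = h or g = - h on the complement of the
   two-torsion. *)
Definition representatives (J : {set G}) : Prop :=
  (forall g, g \in J -> ~~ two_torsion g) /\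
  (forall g, ~~ two_torsion g -> exists! h, h \in J /\ (h = g \/ h = - g)).

End Haagerup.
Arguments haagerup_dim R G : clear implicits.

(* Main.v *)
(* Write X = iotabar rho iota, which contains iotabar kappa. An element e of
   (X, X) is determined by g = gamma rho(V0^* ) e V0 in (rho gamma, gamma rho),
   and by Schur's lemma g has four components, in (rho, rho), (rho^2, rho),
   (rho, rho^2) and (rho^2, rho^2). Rotation by pi is an antiautomorphism of
   (X, X). It fixes the first and the last component, because (rho^2, rho^2) is
   spanned by projections onto pairwise inequivalent irreducibles, and it swaps
   the two others, which are one-dimensional. So every commutator of two
   rotation-invariant elements is a multiple of one explicit element, which
   does not vanish on the copy of iotabar iota in X. Hence the invariant
   elements of (iotabar kappa, iotabar kappa) commute, and they have
   codimension at most one there. But every subspace of codimension one of the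
   2 x 2 matrices is noncommutative, so no multiplicity exceeds 1. *)
Require Import Defs.
From mathcomp Require Import all_boot all_order all_algebra.
From mathcomp Require Import complex ring lra.
From mathcomp Require Import all_classical all_reals all_analysis.

Set Implicit Arguments.
Unset Strict Implicit.
Unset Printing Implicit Defensive.
Import Order.TTheory GRing.Theory Num.Theory.
Local Open Scope classical_set_scope.
Local Open Scope complex_scope.
Local Open Scope ring_scope.

Local Notation "x ^*" := (star x) : ring_scope.

(** * Rewriting inside left-associated products *)

Section Contextual.
Context {M : nzRingType}.
Implicit Types a b c d z : M.

(** Products are kept left-associated, so a relation between two factors has to be applied behind an
    arbitrary prefix [z]. *)
Lemma mul_ctx a b c : a * b = c -> forall z, z * a * b = z * c.
Proof. by move=> abE z; rewrite -mulrA abE. Qed.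

Lemma mul_ctx2 a b c d : a * b = c * d -> forall z, z * a * b = z * c * d.
Proof. by move=> abE z; rewrite -!mulrA abE. Qed.

End Contextual.

(** * Star algebras and their unital endomorphisms *)

Section StarHom.
Context {R : rcfType} {M : starAlgType R}.
Implicit Types x y : M.

Lemma star1 : (1 : M)^* = 1.
Proof. by rewrite -[LHS]mulr1 -{2}[1]starK -starM mulr1 starK. Qed.

Lemma star0 : (0 : M)^* = 0.
Proof. by rewrite -(scale0r (0 : M)) starZ rmorph0 !scale0r. Qed.

Lemma starN x : (- x)^* = - x^*.
Proof. by apply: (addrI x^*); rewrite -starD !subrr star0. Qed.

Lemma starB x y : (x - y)^* = x^* - y^*.
Proof. by rewrite starD starN. Qed.

Variables (s : M -> M) (hs : unital_hom setT setT s).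

Lemma hom1 : s 1 = 1. Proof. by case: hs. Qed.

Lemma homM x y : s (x * y) = s x * s y.
Proof. by case: hs => _ _ _ sM _; apply: sM. Qed.

Lemma hom_star x : s x^* = (s x)^*.
Proof. by case: hs => _ _ _ _ sS; apply: sS. Qed.

Lemma homD x y : s (x + y) = s x + s y.
Proof. by case: hs => _ _ /(_ 1 x y I I); rewrite !scale1r. Qed.

Lemma hom0 : s 0 = 0.
Proof. by apply: (addrI (s 0)); rewrite -homD !addr0. Qed.

Lemma homZ a x : s (a *: x) = a *: s x.
Proof.
by case: hs => _ _ /(_ a x 0 I I) + _ _; rewrite hom0 !addr0.
Qed.

Lemma homN x : s (- x) = - s x.
Proof. by rewrite -scaleN1r homZ scaleN1r. Qed.

Lemma homB x y : s (x - y) = s x - s y.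
Proof. by rewrite homD homN. Qed.

Lemma hom_sum (I : finType) (F : I -> M) :
  s (\sum_i F i) = \sum_i s (F i).
Proof. by elim/big_rec2: _ => [|i _ y _ <-]; rewrite ?hom0 ?homD. Qed.

End StarHom.

(** * Rotation of the self-intertwiners of iotabar rho iota *)

Section Rotation.
Context {R : rcfType} {M : starAlgType R}.
Variables (rho gamma : M -> M) (V W S : M) (l : R[i]).
Hypotheses (hrho : unital_hom setT setT rho)
  (hgamma : unital_hom setT setT gamma)
  (Vgamma : forall y, V * y = gamma y * V)
  (Wgamma : forall y, W * gamma y = gamma (gamma y) * W)
  (VW : V^* * W = 1) (gVW : gamma V^* * W = 1)
  (WW : W * W = gamma W * W) (WWs : W * W^* = gamma W^* * W)
  (Srho : forall y, S * y = rho (rho y) * S)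
  (SS : S^* * rho S = l *: 1) (l_neq0 : l != 0).

Local Notation gr x := (gamma (rho x)).
Local Notation rM := (homM hrho).
Local Notation gM := (homM hgamma).

Definition subalg : set M :=
  [set x | W * x = gamma x * W /\ W * x^* = gamma x^* * W].

(* For N = [subalg], iota : N -> M and X = iotabar rho iota, [endo] is (X, X)
   and [twist] is (rho gamma, gamma rho). *)
Definition endo : set M :=
  [set e | subalg e /\ forall x, subalg x -> e * gr x = gr x * e].

Definition twist : set M :=
  [set g | forall y, g * rho (gamma y) = gr y * g].

Definition unfold e := gr V^* * e * V.

Lemma star_gammaV x : x * V^* = V^* * gamma x.
Proof.
by apply: (can_inj starK); rewrite !starM starK -(hom_star hgamma) -Vgamma.
Qed.

Lemma subalg_star x : subalg x -> x * W^* = W^* * gamma x.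
Proof.
move=> [_ Wx]; apply: (can_inj starK); rewrite !starM !starK Wx.
by rewrite (hom_star hgamma).
Qed.

Lemma star_W_gammaV : W^* * gamma V = 1.
Proof.
by apply: (can_inj starK); rewrite starM starK -(hom_star hgamma) gVW star1.
Qed.

Lemma subalg_gamma y : subalg (gamma y).
Proof. by split; rewrite -?(hom_star hgamma); apply: Wgamma. Qed.

Lemma subalg_W : subalg W. Proof. by split. Qed.

Lemma subalgM x y : subalg x -> subalg y -> subalg (x * y).
Proof.
move=> [x1 x2] [y1 y2]; split.
  by rewrite gM mulrA x1 -!mulrA y1.
by rewrite starM gM mulrA y2 -!mulrA x2.
Qed.

Lemma subalgB x y : subalg x -> subalg y -> subalg (x - y).
Proof.
move=> [x1 x2] [y1 y2]; split.
  by rewrite mulrBr x1 y1 (homB hgamma) mulrBl.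
by rewrite starB mulrBr x2 y2 (homB hgamma) mulrBl.
Qed.

Lemma subalgZ a x : subalg x -> subalg (a *: x).
Proof.
move=> [x1 x2]; split.
  by rewrite -scalerAr x1 (homZ hgamma) scalerAl.
by rewrite starZ -scalerAr x2 (homZ hgamma) scalerAl.
Qed.

Lemma endoM e f : endo e -> endo f -> endo (e * f).
Proof.
move=> [Ne ce] [Nf cf]; split; first exact: subalgM.
by move=> x Nx; rewrite -mulrA cf // mulrA ce // mulrA.
Qed.

Lemma endoB e f : endo e -> endo f -> endo (e - f).
Proof.
move=> [Ne ce] [Nf cf]; split; first exact: subalgB.
by move=> x Nx; rewrite mulrBl mulrBr ce // cf.
Qed.

Lemma endoZ a e : endo e -> endo (a *: e).
Proof.
move=> [Ne ce]; split; first exact: subalgZ.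
by move=> x Nx; rewrite -scalerAl -scalerAr ce.
Qed.

Lemma unfold_twist e : endo e -> twist (unfold e).
Proof.
move=> [Ne ce] y; rewrite /unfold -mulrA Vgamma mulrA.
rewrite (mul_ctx2 (ce _ (subalg_gamma y))) !mulrA; congr (_ * _ * _).
by rewrite -!gM -!rM -star_gammaV.
Qed.

Lemma unfoldW e : endo e -> unfold e * rho W = e * V.
Proof.
move=> [Ne ce]; rewrite /unfold -mulrA Vgamma mulrA.
rewrite (mul_ctx2 (ce _ subalg_W)) -gM -rM.
by rewrite VW (hom1 hrho) (hom1 hgamma) mul1r.
Qed.

(** Unfolding loses nothing: [W^*] and [gamma V] bend the legs back, and [e] passes [W^*] because it
    lies in [subalg]. *)
Lemma unfoldK e : endo e -> W^* * gamma (unfold e * rho W) = e.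
Proof.
move=> he; rewrite unfoldW // gM mulrA -subalg_star; last by case: he.
by rewrite -mulrA star_W_gammaV mulr1.
Qed.

(* Lies in (id, X X) and, up to a scalar, solves the conjugate equations for
   the self-conjugate X. *)
Definition cup := gamma (rho V * S) * W.

Lemma gr_cup g : gamma (rho (g * rho W)) * gamma S * W =
  gr g * gamma S * W * W.
Proof. by rewrite -gM rM -mulrA -Srho !gM -!mulrA WW. Qed.

(** Here [gr e] is X applied to [e], so [e] acts on the inner leg of the cup; in [endo_cup] it acts
    on the outer leg. *)
Lemma gr_endo_cup e : endo e ->
  gr e * cup = gr (unfold e) * gamma S * W * W.
Proof.
by move=> he; rewrite -gr_cup unfoldW // /cup rM !gM !mulrA.
Qed.

Lemma endo_cup e : endo e ->
  e * cup = W^* * gamma (unfold e * rho (W * V) * S) * W.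
Proof.
move=> he; rewrite /cup -{1}(unfoldK he) !mulrA; congr (_ * W).
by rewrite !gM rM gM !mulrA.
Qed.

(* g' is the rotation of g by pi: it closes up the other side of g. *)
Definition rotation g g' := g * rho (W * V) * S = gr g' * gamma S * W * V.

(** Compared with [gr_endo_cup], only the unfolding is replaced by its rotation: sliding [e] from
    one leg of the cup to the other is rotation by pi. *)
Lemma endo_cup_rotation e g : endo e -> rotation (unfold e) g ->
  e * cup = gr g * gamma S * W * W.
Proof.
move=> he rot; rewrite endo_cup // rot -gM.
have Ws y : W^* * gamma (gamma y) = gamma y * W^*.
  by rewrite (subalg_star (subalg_gamma y)).
rewrite gM (gM _ W) !mulrA Ws (mul_ctx (esym (subalg_star subalg_W))).
by rewrite mulrA (mul_ctx star_W_gammaV) mulr1.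
Qed.

(** Applying [rho] to [rho z * S] and multiplying by [S^*] on the left returns [l *: z]. *)
Lemma rho_S_inj z : rho z * S = 0 -> z = 0.
Proof.
move=> /(congr1 rho); rewrite rM (hom0 hrho) => /(congr1 (fun y => S^* * y)).
have -> : S^* * (rho (rho z) * rho S) = z * S^* * rho S.
  rewrite mulrA; congr (_ * _); apply: (can_inj starK).
  by rewrite !starM !starK -!(hom_star hrho) Srho.
rewrite -mulrA SS mulr0 -scalerAr mulr1 => /eqP.
by rewrite scaler_eq0 (negPf l_neq0) => /eqP.
Qed.

(** [V^*] strips [gamma], [rho_S_inj] strips [rho] and [S], and [gr V^*] cancels the remaining
    [rho W]. *)
Lemma twist_cup_eq0 g : twist g -> gr g * gamma S * W * W = 0 -> g = 0.
Proof.
move=> tg; rewrite -gr_cup => /(congr1 (fun y => V^* * y)).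
rewrite -gM !mulrA -star_gammaV mulr0 -mulrA VW mulr1 => /rho_S_inj gW.
have := congr1 (fun y => gr V^* * y) gW.
by rewrite mulr0 mulrA -tg -mulrA -rM gVW (hom1 hrho) mulr1.
Qed.

(** The two equations on [cup] express rotation invariance. Sliding two elements around the cup
    reverses their product, so their commutator changes sign. *)
Lemma commutator_antisym e f : endo e -> endo f ->
  e * cup = gr e * cup -> f * cup = gr f * cup ->
  (e * f - f * e) * cup = - (gr (e * f - f * e) * cup).
Proof.
have E a b : endo a -> endo b -> a * cup = gr a * cup ->
    b * cup = gr b * cup -> a * b * cup = gr (b * a) * cup.
  move=> [Na ca] [Nb cb] sa sb.
  by rewrite -mulrA sb mulrA ca // -mulrA sa mulrA -gM -rM.
move=> he hf se sf; rewrite mulrBl !E // -mulrBl -(homB hgamma) -(homB hrho).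
by rewrite -[RHS]mulNr -(homN hgamma) -(homN hrho) opprB.
Qed.

End Rotation.

(** * Commuting subspaces of the 2 x 2 matrices *)

Section MatrixUnits.
Context {R : rcfType} {M : starAlgType R}.

(* The kernel of a functional on the 2 x 2 matrices is never commutative. *)
Lemma matrix_units_commute (w : bool -> M) (A : set M) (D : M -> M) (t : M) :
  (forall i j, (w i)^* * w j = (i == j)%:R) ->
  (forall x y, A x -> A y -> A (x - y)) ->
  (forall a x, A x -> A (a *: x)) ->
  (forall i j, A (w i * (w j)^*)) ->
  (forall x y, D (x - y) = D x - D y) ->
  (forall a x, D (a *: x) = a *: D x) ->
  (forall x, A x -> exists a, D x = a *: t) ->
  (forall x y, A x -> A y -> D x = 0 -> D y = 0 -> x * y = y * x) -> False.
Proof.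
move=> ww AB AZ Aw DB DZ Dt comm.
pose e i j := w i * (w j)^*.
have ee i j k l : e i j * e k l = (j == k)%:R *: e i l.
  rewrite /e mulrA -[w i * _ * _]mulrA ww; case: eqP => _.
    by rewrite mulr1 scale1r.
  by rewrite mulr0 mul0r scale0r.
have e_neq0 i j : e i j <> 0.
  move/(congr1 (fun x => (w i)^* * x * w j)).
  rewrite mulr0 mul0r /e !mulrA ww eqxx mul1r ww eqxx => /eqP.
  by rewrite oner_eq0.
pose f := false; pose u := true.
have /Dt [c12 E12] := Aw f u; have /Dt [c21 E21] := Aw u f.
have /Dt [c11 E11] := Aw f f.
have [c12_0|c12_neq0] := eqVneq c12 0; last first.
  (* With [c12] as pivot, both combinations are annihilated by [D]. *)
  pose x := c12 *: e f f - c11 *: e f u; pose y := c12 *: e u f - c21 *: e f u.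
  have Dx : D x = 0.
    by rewrite DB !DZ E11 E12 !scalerA mulrC subrr.
  have Dy : D y = 0.
    by rewrite DB !DZ E21 E12 !scalerA mulrC subrr.
  have xy : x * y = y * x by apply: comm => //; apply/AB; apply/AZ/Aw.
  (* The compression isolates the entry at (u, f): it is 0 in [x * y] and [c12 ^+ 2] in [y * x]. *)
  have := congr1 (fun z => e u u * z * e f f) xy.
  have simp := (scale0r, scale1r, scaler0, mul0r, mulr0, subr0, sub0r, oppr0,
    addr0, ee).
  rewrite /x /y !(mulrBl, mulrBr) -!(scalerAl, scalerAr) !ee /=.
  rewrite !simp => /esym/eqP.
  by rewrite !scaler_eq0 (negPf c12_neq0) => /eqP /e_neq0.
have [c21_0|c21_neq0] := eqVneq c21 0.
  (* Both off-diagonal units now lie in the kernel of [D]. *)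
  have : e f u * e u f = e u f * e f u.
    by apply: comm; rewrite ?E12 ?E21 ?c12_0 ?c21_0 ?scale0r //; apply: Aw.
  move/(congr1 (fun z => e f f * z)).
  by rewrite !ee !scale1r !ee /= scale1r scale0r => /e_neq0.
(* As [c12 = 0], the unit [e f u] is in the kernel of [D]; a second element is built with [c21] as
   pivot. *)
pose y := c21 *: e f f - c11 *: e u f.
have Dy : D y = 0 by rewrite DB !DZ E21 E11 !scalerA mulrC subrr.
have xy : e f u * y = y * e f u.
  by apply: comm; rewrite ?E12 ?c12_0 ?scale0r //; try apply/AB; try apply/AZ;
    apply/Aw.
have := congr1 (fun z => e f f * z * e u u) xy.
have simp := (scale0r, scale1r, scaler0, mul0r, mulr0, subr0, sub0r, oppr0,
  addr0, ee).
rewrite /y !(mulrBl, mulrBr) -!(scalerAl, scalerAr) !ee /=.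
rewrite !simp => /esym/eqP.
by rewrite scaler_eq0 (negPf c21_neq0) => /eqP /e_neq0.
Qed.
End MatrixUnits.

(** * The blocks of (rho gamma, gamma rho) and their rotation *)

Section TwistBasis.
Context {R : rcfType} {M : starAlgType R}.
Variables (rho gamma : M -> M) (V0 V1 W S T : M) (k : R[i]).
Local Notation gr x := (gamma (rho x)).
Hypotheses (hrho : unital_hom setT setT rho)
  (V00 : V0^* * V0 = 1) (V11 : V1^* * V1 = 1)
  (VV : V0 * V0^* + V1 * V1^* = 1)
  (gammaE : forall y, gamma y = V0 * y * V0^* + V1 * rho y * V1^*).

(** Compressing [VV] yields [V0^* * V1] twice on the left and once on the right. *)
Lemma V0s_V1 : V0^* * V1 = 0.
Proof.
have := congr1 (fun z => V0^* * z * V1) VV.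
rewrite mulr1 mulrDr mulrDl !mulrA V00 mul1r -mulrA V11 mulr1 => /eqP.
by rewrite -subr_eq0 addrK => /eqP.
Qed.

Lemma V1s_V0 : V1^* * V0 = 0.
Proof. by apply: (can_inj starK); rewrite starM starK V0s_V1 star0. Qed.

Lemma gammaV0 y : gamma y * V0 = V0 * y.
Proof.
by rewrite gammaE mulrDl -!mulrA V00 V1s_V0 !mulr0 addr0 mulr1.
Qed.

Lemma gammaV1 y : gamma y * V1 = V1 * rho y.
Proof. by rewrite gammaE mulrDl -!mulrA V11 V0s_V1 !mulr0 add0r mulr1. Qed.

Lemma V0sgamma y : V0^* * gamma y = y * V0^*.
Proof. by rewrite gammaE mulrDr !mulrA V00 V0s_V1 !mul0r addr0 mul1r. Qed.

Lemma V1sgamma y : V1^* * gamma y = rho y * V1^*.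
Proof. by rewrite gammaE mulrDr !mulrA V11 V1s_V0 !mul0r add0r mul1r. Qed.

Lemma gamma_hom : unital_hom setT setT gamma.
Proof.
split=> //.
- by rewrite gammaE (hom1 hrho) !mulr1.
- move=> a x y _ _; rewrite !gammaE (homD hrho) (homZ hrho) !mulrDr !mulrDl.
  by rewrite -!(scalerAl, scalerAr) scalerDr addrACA.
- move=> x y _ _; rewrite [gamma y]gammaE mulrDr !mulrA gammaV0 gammaV1.
  by rewrite gammaE (homM hrho) !mulrA.
- move=> x _; rewrite !gammaE starD !starM !starK (hom_star hrho).
  by rewrite !mulrA.
Qed.

(** In the application [T] is [T 0] and [k] is the square root of d. The relations [rTS] and [rTsS]
    encode [eta 0 = 1]. *)
Hypotheses (WV0 : W * V0 = V0 * V0 + k *: (V1 * rho V1 * S)) (k_neq0 : k != 0)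
  (Srho : forall y, S * y = rho (rho y) * S)
  (Trho : forall y, T * rho y = rho (rho y) * T)
  (TT : T^* * T = 1) (rTS : rho T * S = T * S)
  (TsS : T^* * rho S = k^-1 *: T) (rTsS : rho T^* * S = k^-1 *: T)
  (rho_irr : forall x, (forall y, x * rho y = rho y * x) ->
     exists a : R[i], x = a *: 1)
  (rho_rho2 : forall x, (forall y, x * rho y = rho (rho y) * x) ->
     exists a : R[i], x = a *: T)
  (* the rotation by pi fixes (rho^2, rho^2) *)
  (rho2_sym : forall x, (forall y, x * rho (rho y) = rho (rho y) * x) ->
     x * rho S * S = rho (rho x) * rho S * S).

Local Notation rM := (homM hrho).
Local Notation gM := (homM gamma_hom).
Local Notation rot := (rotation rho gamma V0 W S).

(** A 2 x 2 block matrix: [V0], [V1] split gamma rho and [rho V0], [rho V1] split rho gamma, each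
    into rho and rho^2. The mixed blocks are multiples of [T] and [T^*]. *)
Definition twist_comb a b b' x :=
  a *: (V0 * rho V0^*) + b *: (V0 * T^* * rho V1^*)
  + b' *: (V1 * T * rho V0^*) + V1 * x * rho V1^*.

Lemma V0srho y : rho V0^* * rho (gamma y) = rho y * rho V0^*.
Proof. by rewrite -!rM V0sgamma. Qed.

Lemma V1srho y : rho V1^* * rho (gamma y) = rho (rho y) * rho V1^*.
Proof. by rewrite -!rM V1sgamma. Qed.

Lemma star_T_rho2 y : T^* * rho (rho y) = rho y * T^*.
Proof.
by apply: (can_inj starK); rewrite !starM starK -!(hom_star hrho) Trho.
Qed.

Lemma twist_combP g : twist rho gamma g -> exists a b b' x,
  (forall y, x * rho (rho y) = rho (rho y) * x) /\ g = twist_comb a b b' x.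
Proof.
move=> tg.
have tgV0 y : g * rho V0 * rho y = gr y * (g * rho V0).
  by rewrite -(mulrA g) -rM -gammaV0 rM !mulrA tg.
have tgV1 y : g * rho V1 * rho (rho y) = gr y * (g * rho V1).
  by rewrite -(mulrA g) -rM -gammaV1 rM !mulrA tg.
have [y|a Ea] := rho_irr (x := V0^* * (g * rho V0)).
  by rewrite -mulrA tgV0 mulrA V0sgamma -mulrA.
have [y|b' Eb'] := rho_rho2 (x := V1^* * (g * rho V0)).
  by rewrite -mulrA tgV0 mulrA V1sgamma -mulrA.
(* The block in (rho^2, rho) is treated through its adjoint in (rho, rho^2), which is why its
   coefficient is conjugated below. *)
have [y|b Eb] := rho_rho2 (x := (V0^* * (g * rho V1))^*).
  move: (g * rho V1) tgV1 => z zV1; apply: (can_inj starK).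
  rewrite !starM !starK -!(hom_star hrho) -mulrA zV1.
  by rewrite [RHS]mulrA V0sgamma mulrA.
exists a, (Num.conj b), b', (V1^* * (g * rho V1)); split.
  by move=> y; rewrite -mulrA tgV1 mulrA V1sgamma -mulrA.
transitivity ((V0 * V0^* + V1 * V1^*) * (g * rho (V0 * V0^* + V1 * V1^*))).
  by rewrite VV (hom1 hrho) mulr1 mul1r.
rewrite (homD hrho) !rM mulrDr !mulrDl !mulrDr !mulrA /twist_comb.
have {}Eb : V0^* * (g * rho V1) = Num.conj b *: T^*.
  by apply: (can_inj starK); rewrite Eb starZ starK conjCK.
have F x x' y c z : x^* * (g * rho y) = c *: z ->
    x' * x^* * g * rho y * rho y^* = c *: (x' * z * rho y^*).
  by move=> E; rewrite -2!(mulrA x') -(mulrA x^*) E -scalerAr -scalerAl.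
rewrite (F _ _ _ _ _ Ea) (F _ _ _ _ _ Eb) (F _ _ _ _ _ Eb') mulr1 !addrA.
by rewrite !mulrA.
Qed.

Lemma comb_twist a b b' x :
  (forall y, x * rho (rho y) = rho (rho y) * x) ->
  twist rho gamma (twist_comb a b b' x).
Proof.
move=> xr y; rewrite /twist_comb !(mulrDl, mulrDr) -!(scalerAl, scalerAr).
rewrite !mulrA !gammaV0 !gammaV1.
rewrite !(mul_ctx2 (V0srho _)) !(mul_ctx2 (V1srho _)).
by rewrite (mul_ctx2 (star_T_rho2 _)) (mul_ctx2 (Trho _)) (mul_ctx2 (xr _)).
Qed.

Lemma V1sWV0 : V1^* * (W * V0) = k *: (rho V1 * S).
Proof.
by rewrite WV0 mulrDr -scalerAr !mulrA V1s_V0 V11 mul0r add0r mul1r.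
Qed.

Lemma V0sWV0 : V0^* * (W * V0) = V0.
Proof.
by rewrite WV0 mulrDr -scalerAr !mulrA V00 V0s_V1 !mul0r scaler0 addr0 mul1r.
Qed.

Lemma gV0sWV0 : gamma V0^* * (W * V0) = V0.
Proof.
rewrite WV0 mulrDr mulrA gammaV0 -scalerAr -mulrA V00 mulr1 !mulrA gammaV1.
by rewrite -(mulrA V1) -rM V0s_V1 (hom0 hrho) mulr0 mul0r scaler0 addr0.
Qed.

Lemma gV1sWV0 : gamma V1^* * (W * V0) = k *: (V1 * S).
Proof.
rewrite WV0 mulrDr mulrA gammaV0 -scalerAr -mulrA V1s_V0 mulr0 !mulrA gammaV1.
by rewrite -(mulrA V1) -rM V11 (hom1 hrho) mulr1 add0r.
Qed.

(** Both sides of [rotation] are linear, so each block is checked separately. In the mixed blocks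
    the factor [k^-1] from [TsS] or [rTsS] cancels the [k] in [WV0], and [rTS] matches the rest; the
    last block is [rho2_sym]. *)
Lemma rotation_comb a b b' x :
  (forall y, x * rho (rho y) = rho (rho y) * x) ->
  rot (twist_comb a b b' x) (twist_comb a b' b x).
Proof.
move=> xr; rewrite /rotation.
have gS g : gr g * gamma S * W * V0 = gamma (rho g * S) * (W * V0).
  by rewrite gM !mulrA.
have lhs p q : p * rho q * rho (W * V0) * S = p * (rho (q * (W * V0)) * S).
  by rewrite (rM q) !mulrA.
have rhs p q : gamma (rho (p * rho q) * S) * (W * V0) =
    gamma (rho p * S) * (gamma q * (W * V0)).
  by rewrite (rM p) -mulrA -Srho (mulrA (rho p)) (gM _ q) -mulrA.
have H00 : V0 * rho V0^* * rho (W * V0) * S =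
    gamma (rho (V0 * rho V0^*) * S) * (W * V0).
  by rewrite lhs rhs V0sWV0 gV0sWV0 gammaV0.
have H01 : V0 * T^* * rho V1^* * rho (W * V0) * S =
    gamma (rho (V1 * T * rho V0^*) * S) * (W * V0).
  rewrite lhs rhs V1sWV0 gV0sWV0 gammaV0 (homZ hrho) -scalerAl -scalerAr.
  rewrite (rM _ S) -!mulrA (mulrA T^*) star_T_rho2 -(mulrA (rho V1)) (mulrA
    T^*) TsS.
  rewrite -scalerAl -!scalerAr scalerA divff // scale1r -rTS.
  by rewrite (rM V1) !mulrA.
have H10 : V1 * T * rho V0^* * rho (W * V0) * S =
    gamma (rho (V0 * T^* * rho V1^*) * S) * (W * V0).
  rewrite lhs rhs V0sWV0 gV1sWV0 -scalerAr (mulrA (gamma _)) gammaV1 (rM V0)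
    -(mulrA (rho V0)).
  rewrite rTsS -scalerAr (homZ hrho) -scalerAr -scalerAl scalerA divff //.
  by rewrite scale1r (rM _ T) -!mulrA rTS (mulrA T) Trho !mulrA.
have H11 : V1 * x * rho V1^* * rho (W * V0) * S =
    gamma (rho (V1 * x * rho V1^*) * S) * (W * V0).
  rewrite lhs rhs V1sWV0 gV1sWV0 -scalerAr (mulrA (gamma _)) gammaV1 (homZ
    hrho).
  rewrite -scalerAl -scalerAr; congr (_ *: _).
  rewrite !rM -!mulrA; congr (_ * _).
  by rewrite (mulrA x) xr -!mulrA; congr (_ * _); rewrite !mulrA rho2_sym.
rewrite gS /twist_comb.
rewrite !(homD hrho, homZ hrho) !mulrDl -!scalerAl.
rewrite !(homD gamma_hom, homZ gamma_hom) !mulrDl -!scalerAl.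
by rewrite H00 H01 H10 H11; congr (_ + _); rewrite addrAC.
Qed.


Hypotheses (Wgamma : forall y, W * gamma y = gamma (gamma y) * W)
  (VW : V0^* * W = 1) (gVW : gamma V0^* * W = 1)
  (WW : W * W = gamma W * W) (WWs : W * W^* = gamma W^* * W)
  (l : R[i]) (SS : S^* * rho S = l *: 1) (l_neq0 : l != 0).

Let Vgamma y := esym (gammaV0 y).
Local Notation endo := (endo rho gamma W).
Local Notation cup := (cup rho gamma V0 W S).
Local Notation unfold := (unfold rho gamma V0).
Local Notation unfoldP := (unfold_twist hrho gamma_hom Vgamma Wgamma).

(** The two actions of [e] on the cup are images under one linear map of block matrices that differ
    only by exchanging [b] and [b']. *)
Lemma endo_comb e : endo e -> exists a b b' x,
  [/\ forall y, x * rho (rho y) = rho (rho y) * x,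
    unfold e = twist_comb a b b' x,
    e * cup = gr (twist_comb a b' b x) * gamma S * W * W &
    gr e * cup = gr (twist_comb a b b' x) * gamma S * W * W].
Proof.
move=> he; have [a [b [b' [x [xr eE]]]]] := twist_combP (unfoldP he).
exists a, b, b', x; split=> //; last first.
  by rewrite -eE; apply: gr_endo_cup => //; apply: gamma_hom.
apply: endo_cup_rotation => //; first exact: gamma_hom.
by rewrite eE; apply: rotation_comb.
Qed.

(** The factor is [b - b']. This is the functional whose kernel consists of the rotation-invariant
    elements. *)
Lemma rotation_defect e : endo e -> exists c : R[i], e * cup - gr e * cup =
  c *: (gr (twist_comb 0 (-1) 1 0) * gamma S * W * W).
Proof.
move=> /endo_comb[a [b [b' [x [xr _ -> ->]]]]]; exists (b - b').
rewrite -!mulrBl -(homB gamma_hom) -(homB hrho) !scalerAl.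
rewrite -(homZ gamma_hom) -(homZ hrho); congr (gr _ * _ * _ * _).
rewrite /twist_comb mulr0 mul0r addr0 scale0r add0r scalerDr !scalerA.
rewrite mulr1 mulrN1 opprB !opprD addrACA subrr addr0 addrACA.
by rewrite [X in X + _]addrACA subrr add0r -!scalerBl.
Qed.


Lemma twist_comb_coef00 a b b' x : V0^* * twist_comb a b b' x * rho V0 = a *: 1.
Proof.
rewrite /twist_comb !mulrDr !mulrDl -!(scalerAl, scalerAr) !mulrA V00 V0s_V1.
rewrite !mul0r scaler0 !addr0 !mul1r -(mulrA T^*) -!rM V00 V1s_V0 (hom1 hrho).
by rewrite (hom0 hrho) mulr0 scaler0 addr0.
Qed.

Lemma twist_comb_coef10 a b b' x : V1^* * twist_comb a b b' x * rho V0 = b' *: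
  T.
Proof.
rewrite /twist_comb !mulrDr !mulrDl -!(scalerAl, scalerAr) !mulrA V11 V1s_V0.
rewrite !mul0r !scaler0 !add0r !mul1r -!mulrA -!rM V00 V1s_V0 (hom1 hrho).
by rewrite (hom0 hrho) mulr0 mulr1 addr0.
Qed.

Lemma twist_comb_coef11 a b b' x : V1^* * twist_comb a b b' x * rho V1 = x.
Proof.
rewrite /twist_comb !mulrDr !mulrDl -!(scalerAl, scalerAr) !mulrA V11 V1s_V0.
rewrite !mul0r !scaler0 !add0r !mul1r -!mulrA -!rM V11 V0s_V1 (hom1 hrho).
by rewrite (hom0 hrho) mulr0 mulr1 scaler0 add0r.
Qed.

Lemma half_eq0 (x : M) : x + x = 0 -> x = 0.
Proof.
move/eqP; rewrite -mulr2n -scaler_nat scaler_eq0 pnatr_eq0 /=.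
by move/eqP.
Qed.

(** Antisymmetry forces [a = 0], [x = 0] and [b + b' = 0], which leaves one free scalar. Vanishing
    on [gamma X] then gives [b' = 0], since [T] and [X] are isometries. *)
Lemma antisym_eq0 y X : endo y -> y * cup = - (gr y * cup) ->
  y * gamma X = 0 -> X^* * X = 1 -> y = 0.
Proof.
move=> hy anti yX XX.
have [a [b [b' [x [xr yE ye ey]]]]] := endo_comb hy.
have s0 : twist_comb a b' b x + twist_comb a b b' x = 0.
  apply: (twist_cup_eq0 hrho gamma_hom Vgamma VW gVW WW Srho SS l_neq0).
    move=> z; rewrite mulrDl mulrDr.
    by congr (_ + _); apply: comb_twist.
  rewrite (homD hrho) (homD gamma_hom) !mulrDl -ye -ey anti.
  by rewrite addNr.
(* Evaluating [y * gamma X] on [V0] gives [y * V0 * X], which [unfoldW] turns into an expression in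
   the unfolding of [y]. *)
have g : V1^* * twist_comb a b b' x * rho W * X = 0.
  have : y * gamma X * V0 = 0 by rewrite yX mul0r.
  rewrite -mulrA gammaV0 mulrA.
  rewrite -(unfoldW hrho gamma_hom Vgamma VW WW WWs hy) yE.
  by move/(congr1 (fun z => V1^* * z)); rewrite mulr0 !mulrA.
have ext u v : u * (twist_comb a b' b x) * v + u * (twist_comb a b b' x) * v =
  0.
  by rewrite -mulrDl -mulrDr s0 mulr0 mul0r.
have x0 : x = 0.
  by apply: half_eq0; have := ext V1^* (rho V1); rewrite !twist_comb_coef11.
have a0 : a *: (1 : M) = 0.
  by apply: half_eq0; have := ext V0^* (rho V0); rewrite !twist_comb_coef00.
have {}a0 : a = 0.
  by move/eqP: a0; rewrite scaler_eq0 oner_eq0 orbF => /eqP.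
have bb : b *: T + b' *: T = 0.
  by have := ext V1^* (rho V0); rewrite !twist_comb_coef10.
have T_inj c : c *: T = 0 -> c = 0.
  move/(congr1 (fun z => T^* * z)) => /eqP.
  by rewrite mulr0 -scalerAr TT scaler_eq0 oner_eq0 orbF => /eqP.
have b'0 : b' = 0.
  have := g; rewrite /twist_comb a0 x0 mulr0 mul0r addr0.
  rewrite scale0r add0r mulrDr -!scalerAr !mulrA V11 V1s_V0 !mul0r scaler0
    add0r.
  rewrite mul1r -!scalerAl -(mulrA T) -rM VW (hom1 hrho) mulr1 => TX.
  have /eqP := congr1 (fun z => X^* * (T^* * z)) TX.
  rewrite -!scalerAr (mulrA T^*) TT mul1r XX !mulr0 scaler_eq0 oner_eq0 orbF.
  by move/eqP.
have b0 : b = 0 by apply: T_inj; move: bb; rewrite b'0 scale0r addr0.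
rewrite -(unfoldK hrho gamma_hom Vgamma VW gVW WW WWs hy) yE.
rewrite a0 b0 b'0 x0 /twist_comb !scale0r mulr0 !mul0r !addr0 mul0r.
by rewrite (hom0 gamma_hom) mulr0.
Qed.

(** The [w b] are two orthogonal copies of one sector inside X, both orthogonal to the range of
    [gamma X]. The resulting matrix units have a commuting kernel of the rotation defect, which
    [matrix_units_commute] excludes. *)
Lemma multiplicity_free (w : bool -> M) X :
  (forall i j, (w i)^* * w j = (i == j)%:R) ->
  (forall i j, endo (w i * (w j)^*)) ->
  (forall j, (w j)^* * gamma X = 0) -> X^* * X = 1 -> False.
Proof.
move=> ww hw wX XX.
pose A : set M := [set e | endo e /\ e * gamma X = 0].
apply: (@matrix_units_commute _ _ w A (fun e => e * cup - gr e * cup)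
  (gr (twist_comb 0 (-1) 1 0) * gamma S * W * W)) => //.
- move=> x y [hx x0] [hy y0]; split; first exact: (endoB gamma_hom).
  by rewrite mulrBl x0 y0 subrr.
- move=> a x [hx x0]; split; first exact: (endoZ gamma_hom).
  by rewrite -scalerAl x0 scaler0.
- by move=> i j; split; rewrite -?mulrA ?wX ?mulr0.
- move=> x y; rewrite (homB hrho) (homB gamma_hom) !mulrBl.
  by rewrite !opprD opprK addrACA.
- move=> a x; rewrite (homZ hrho) (homZ gamma_hom) -!scalerAl.
  by rewrite scalerBr.
- by move=> x [hx _]; apply: rotation_defect.
move=> x y [hx x0] [hy y0] /eqP; rewrite subr_eq0 => /eqP sx /eqP.
rewrite subr_eq0 => /eqP sy; apply/eqP; rewrite -subr_eq0; apply/eqP.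
apply: (antisym_eq0 (X := X)) => //.
- by apply: (endoB gamma_hom); apply: (endoM gamma_hom).
- exact: (commutator_antisym hrho gamma_hom).
- by rewrite mulrBl -!mulrA x0 y0 !mulr0 subrr.
Qed.

End TwistBasis.

(** * Structure of a generalized Haagerup category *)

Section Positivity.
Context {R : realType} {M : starAlgType R}.

(** An abstract star algebra has no positivity; it comes from the faithful representation, by
    comparing the squared norms of [pi x v] and [v]. *)
Lemma star_square_gt0 (x : M) (c : R[i]) : hyperfinite_III1_factor M ->
  x^* * x = c *: 1 -> x != 0 -> 0 < c.
Proof.
move=> [_ _ [H [ip [pi [_ [[pi_bd pi_lin pi1 piM pi_star] [pi_inj _]] _ _
  _]]]]].
move=> xx x0.
have pi0 : pi 0 = 0.
  have := pi_lin (-1) 0 0; rewrite scaler0 addr0 => ->.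
  by rewrite scaleN1r addNr.
have [v piv] : exists v, pi x v != 0.
  apply: contrapT => /forallNP piv; move/eqP: x0; apply.
  apply: pi_inj; rewrite pi0; apply/funext => v.
  by apply/eqP/negPn/negP/piv.
have ip_v : ip (pi x v) (pi x v) = Num.conj c * ip v v.
  rewrite pi_star -[pi x^* _]/((pi x^* \o pi x) v) -piM xx.
  have := pi_lin c 1 0; rewrite addr0 pi0 addr0 pi1 => ->.
  by rewrite linearZr_LR.
have v0 : v != 0.
  apply: contraNneq piv => ->; have [/(_ (-1) 0 0) + _] := pi_bd x.
  by rewrite scaler0 addr0 scaleN1r addNr => ->.
have := dnorm_gt0 ip (pi x v); rewrite piv ip_v pmulr_lgt0 ?dnorm_gt0 //.
by move=> cc_gt0; rewrite -(conjCK c) conj_Creal // gtr0_real.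
Qed.

Lemma schur (s t : M -> M) x : hyperfinite_III1_factor M ->
  irreducible setT setT s -> irreducible setT setT t ->
  ~ equivalent setT setT s t -> (forall y, x * s y = t y * x) -> x = 0.
Proof.
move=> hM [hs irr_s] [ht irr_t] nst xst; apply: contrapT => /eqP x0; apply: nst.
have xts y : x^* * t y = s y * x^*.
  apply: (can_inj starK); rewrite !starM starK.
  by rewrite -(hom_star hs) -(hom_star ht) xst.
have [|c cE] := irr_s (x^* * x).
  by split=> // y _; rewrite -mulrA xst !mulrA xts.
have [|c' c'E] := irr_t (x * x^*).
  by split=> // y _; rewrite -mulrA xts !mulrA xst.
have c_gt0 := star_square_gt0 hM cE x0.
(* Both scalars multiply [x] in [x * x^* * x]. *)
have cc' : c' = c.
  apply/eqP; rewrite -subr_eq0; have /eqP : (c' - c) *: x = 0.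
    rewrite scalerBl -[in X in X - _](mul1r x) -[in X in _ - X](mulr1 x).
    by rewrite scalerAl -c'E scalerAr -cE mulrA subrr.
  by rewrite scaler_eq0 (negPf x0) orbF.
(* Positivity of [c] allows [x] to be rescaled to a unitary. *)
pose r := (sqrtC c)^-1.
have rr : Num.conj r * r * c = 1.
  have r_gt0 : 0 < r by rewrite invr_gt0 sqrtC_gt0.
  rewrite conj_Creal ?gtr0_real // -expr2 exprVn sqrtCK mulVf //.
  exact: lt0r_neq0.
exists (r *: x).
  by split=> // y _; rewrite -scalerAl -scalerAr xst.
split; rewrite starZ -scalerAl -scalerAr scalerA ?cE ?c'E scalerA ?cc'.
  by rewrite rr scale1r.
by rewrite [r * _]mulrC rr scale1r.
Qed.
End Positivity.

(** * Relations among the isometries [S], [T g] and the numerical data *)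

Section HaagerupData.
Context {R : realType} {M : starAlgType R} {G : finZmodType}.
Variables (C : set (M -> M)) (rho : M -> M) (alpha : G -> M -> M)
  (S : M) (T : G -> M) (eps : G -> G -> R[i]) (eta : G -> R[i])
  (A : G -> G -> G -> R[i]).
Hypotheses (hM : hyperfinite_III1_factor M)
  (hC : generalized_haagerup C rho alpha)
  (hdata : haagerup_data rho alpha S T eps eta A).

Local Notation d := (haagerup_dim R G).
Local Notation D := (d%:C).
Local Notation k := ((Num.sqrt d)%:C).

Lemma rho_hom : unital_hom setT setT rho.
Proof. by case: (gH_irreducible hC). Qed.

Lemma alpha_hom g : unital_hom setT setT (alpha g).
Proof. by case: (gH_action hC). Qed.

Local Notation rM := (homM rho_hom).

Lemma alphaD g h x : alpha (g + h) x = alpha g (alpha h x).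
Proof. by case: (gH_action hC) => _ _ ->. Qed.

Lemma alpha0 x : alpha 0 x = x.
Proof. by case: (gH_action hC) => _ ->. Qed.

Lemma alpha_rho g x : alpha g (rho x) = rho (alpha (- g) x).
Proof. exact: (congr1 (fun f => f x) (gH_commute hC g)). Qed.

Lemma alpha_rho2 g x : alpha g (rho (rho x)) = rho (rho (alpha g x)).
Proof. by rewrite !alpha_rho opprK. Qed.

Lemma alphaNK g x : alpha g (alpha (- g) x) = x.
Proof. by rewrite -alphaD subrr alpha0. Qed.

Lemma alphaKN g x : alpha (- g) (alpha g x) = x.
Proof. by rewrite -alphaD addNr alpha0. Qed.

Lemma d_gt1 : 1 < d.
Proof.
have n_ge1 : (1 : R) <= #|G|%:R by rewrite ler1n; apply/card_gt0P; exists 0.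
have : (1 : R) < Num.sqrt (#|G|%:R ^+ 2 + 4).
  by rewrite -[ltLHS]sqrtr1 ltr_sqrt; have := sqr_ge0 (#|G|%:R : R); lra.
by rewrite /haagerup_dim; lra.
Qed.

(** This is the fusion rule of [rho] read on dimensions. *)
Lemma d_quadratic : d ^+ 2 = 1 + #|G|%:R * d.
Proof.
have : Num.sqrt (#|G|%:R ^+ 2 + 4) ^+ 2 = #|G|%:R ^+ 2 + 4 :> R.
  by rewrite sqr_sqrtr // addr_ge0 ?sqr_ge0.
rewrite /haagerup_dim; move: (Num.sqrt _) => s sE.
by rewrite expr_div_n sqrrD sE; field.
Qed.

Lemma d_gt0 : 0 < d. Proof. exact: lt_trans d_gt1. Qed.

Lemma sqrt_d_sqr : k * k = D.
Proof. by rewrite -rmorphM -expr2 sqr_sqrtr // ltW // d_gt0. Qed.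

Lemma real_conj (a : R) : Num.conj a%:C = a%:C.
Proof. exact: conjc_real. Qed.

Lemma D_neq0 : D != 0.
Proof. by rewrite fmorph_eq0 gt_eqF // d_gt0. Qed.

Lemma D1_neq0 : D - 1 != 0.
Proof. by rewrite -rmorphB fmorph_eq0 subr_eq0 gt_eqF // d_gt1. Qed.

Lemma k_neq0 : k != 0.
Proof. by apply: contraNneq D_neq0 => k0; rewrite -sqrt_d_sqr k0 mul0r. Qed.

Lemma Srho y : S * y = rho (rho y) * S.
Proof. by case: (hd_S hdata) => [[_ ->]]. Qed.

Lemma star_S_S : S^* * S = 1. Proof. by case: (hd_S hdata). Qed.

Lemma Trho g y : T g * alpha g (rho y) = rho (rho y) * T g.
Proof. by case: (hd_T hdata g) => [[_ /(_ y I)]]. Qed.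

Lemma T_isometry g : (T g)^* * T g = 1. Proof. by case: (hd_T hdata g). Qed.

Lemma T_frobenius g : (T g)^* * rho S = k^-1 *: T g.
Proof.
by rewrite -[in RHS](hd_frobenius hdata) scalerA mulVf ?k_neq0 // scale1r.
Qed.

Lemma simple_schur i j x : i != j ->
  (forall y, x * haagerup_simple rho alpha i y =
             haagerup_simple rho alpha j y * x) -> x = 0.
Proof.
move=> ij; apply: (schur hM); try exact: (gH_simple hC).
by move=> /(gH_distinct hC) E; rewrite E eqxx in ij.
Qed.

Lemma rho_irr x : (forall y, x * rho y = rho y * x) ->
  exists a : R[i], x = a *: 1.
Proof. by move=> xr; have [_] := gH_irreducible hC; apply; split. Qed.

Definition summand (o : option G) : M -> M :=
  if o is Some g then alpha g \o rho else id.

Definition summand_index (o : option G) : G * bool :=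
  if o is Some g then (g, true) else (0, false).

Lemma summandE o y : summand o y = haagerup_simple rho alpha (summand_index o)
  y.
Proof. by case: o => [g|] //; rewrite /haagerup_simple /= alpha0. Qed.

Lemma summand_schur o o' x : o != o' ->
  (forall y, x * summand o y = summand o' y * x) -> x = 0.
Proof.
move=> oo' xs; apply: (@simple_schur (summand_index o) (summand_index o')).
  by apply: contra_neq oo' => {xs}; case: o o' => [g|] [g'|] // [->].
by move=> y; rewrite -!summandE.
Qed.

Lemma summand_irr o x : (forall y, x * summand o y = summand o y * x) ->
  exists a : R[i], x = a *: 1.
Proof.
move=> xs; have [_] := gH_simple hC (summand_index o).
by apply; split=> // y _; rewrite -!summandE.
Qed.

Definition component (o : option G) : M := if o is Some g then T g else S.

Lemma component_rho o y : component o * summand o y = rho (rho y) * component o.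
Proof. by case: o => [g|]; [apply: Trho|apply: Srho]. Qed.

Lemma summand_star o x : (forall y, x * summand o y = rho (rho y) * x) ->
  forall y, x^* * rho (rho y) = summand o y * x^*.
Proof.
move=> xs y; apply: (can_inj starK).
have -> : summand o y * x^* = (x * summand o y^*)^*.
  rewrite starM; congr (_ * _); case: o {xs} => [g|] /=; last by rewrite starK.
  by rewrite (hom_star rho_hom) (hom_star (alpha_hom g)) starK.
by rewrite xs !starM !starK -!(hom_star rho_hom).
Qed.

Lemma star_component_rho o y : (component o)^* * rho (rho y) = summand o y *
  (component o)^*.
Proof. by apply: summand_star => z; apply: component_rho. Qed.

Lemma component_orth o o' : (component o)^* * component o' = (o == o')%:R.
Proof.
case: eqP => [<-|/eqP oo'].
  by case: o => [g|]; [apply: T_isometry|apply: star_S_S].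
apply: (@summand_schur o' o); first by rewrite eq_sym.
by move=> y; rewrite -mulrA component_rho !mulrA star_component_rho.
Qed.

(** The fusion rule supplies some complete family [F]. As its summands are pairwise inequivalent,
    Schur's lemma makes each component a phase times the matching [F o], so the range projections
    agree. *)
Lemma component_sum : \sum_o component o * (component o)^* = 1.
Proof.
have [F [_ FF Fsum rrE]] := gH_fusion hC.
have F_rho o y : F o * summand o y = rho (rho y) * F o.
  rewrite -[rho (rho y)]/((rho \o rho) y) rrE // mulr_suml (bigD1 o) //=.
  rewrite -mulrA FF eqxx mulr1 big1 ?addr0 // => o' oo'.
  by rewrite -mulrA FF (negPf oo') mulr0.
have F_ST o o' : o != o' -> (F o)^* * component o' = 0.
  move=> oo'; apply: (@summand_schur o' o); first by rewrite eq_sym.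
  move=> y; rewrite -mulrA component_rho !mulrA.
  by rewrite (summand_star (F_rho o)).
rewrite -[RHS]Fsum; apply: eq_bigr => o _.
have [c cE] : exists c : R[i], (F o)^* * component o = c *: 1.
  apply: (@summand_irr o) => y; rewrite -mulrA component_rho !mulrA.
  by rewrite (summand_star (F_rho o)).
have STE : component o = c *: F o.
  rewrite -[LHS]mul1r -Fsum mulr_suml (bigD1 o) //= -mulrA cE -scalerAr mulr1.
  by rewrite big1 ?addr0 // => o' oo'; rewrite -mulrA F_ST // mulr0.
have cc : Num.conj c * c = 1.
  have /eqP := component_orth o o; rewrite STE starZ -scalerAl -scalerAr
    scalerA FF.
  rewrite eqxx -subr_eq0 -[X in _ - X]scale1r -scalerBl scaler_eq0 oner_eq0.
  by rewrite orbF subr_eq0 => /eqP.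
by rewrite STE starZ -scalerAl -scalerAr scalerA mulrC cc scale1r.
Qed.

Lemma star_T_S g : (T g)^* * S = 0. Proof. exact: (component_orth (Some g)
  None). Qed.

Lemma star_S_T g : S^* * T g = 0. Proof. exact: (component_orth None (Some g)).
  Qed.

Lemma star_T_T g h : (T g)^* * T h = (g == h)%:R.
Proof. exact: (component_orth (Some g) (Some h)). Qed.

Lemma big_option (F : option G -> M) :
  \sum_o F o = F None + \sum_g F (Some g).
Proof.
rewrite (bigD1 None) //= (reindex_omap Some id) => [|[g|]] //=.
by congr (_ + _); apply: eq_bigl => g; rewrite eqxx.
Qed.

Lemma T_neq0 g : T g != 0.
Proof.
by apply: contraPneq (T_isometry g) => ->; rewrite mulr0 => /esym/eqP; rewrite
  oner_eq0.
Qed.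

Lemma star_S_rho y : S^* * rho (rho y) = y * S^*.
Proof. exact: (star_component_rho None). Qed.

(** Irreducibility makes this a scalar. Its value follows by using the Frobenius relation of [T 0]
    twice, once in adjoint form, and moving [T 0] past [rho S]. *)
Lemma star_S_rhoS : S^* * rho S = D^-1 *: 1.
Proof.
have [|c cE] := @rho_irr (S^* * rho S).
  by move=> y; rewrite -mulrA -rM Srho rM mulrA star_S_rho -mulrA.
have T0rho y : T 0 * rho y = rho (rho y) * T 0 by rewrite -Trho alpha0.
have fr := T_frobenius 0.
have fr' : rho S^* * T 0 = k^-1 *: (T 0)^*.
  apply: (can_inj starK); rewrite starM starZ !starK (hom_star rho_hom) starK
    fr.
  by rewrite fmorphV /= real_conj.
have : k^-1 *: (k^-1 *: T 0) = c *: T 0.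
  rewrite -{1}fr scalerAl -fr' -mulrA T0rho mulrA -rM cE (homZ rho_hom).
  by rewrite (hom1 rho_hom) -scalerAl mul1r.
rewrite scalerA -invfM sqrt_d_sqr => /eqP; rewrite -subr_eq0 -scalerBl
  scaler_eq0.
by rewrite (negPf (T_neq0 0)) orbF subr_eq0 cE => /eqP ->.
Qed.

Lemma rho_star_S_S : rho S^* * S = D^-1 *: 1.
Proof.
apply: (can_inj starK); rewrite starM starZ star1 (hom_star rho_hom) starK.
by rewrite star_S_rhoS fmorphV /= real_conj.
Qed.

(** The space (id, rho^2) is spanned by [S], so [alpha g S] is a multiple of [S]; the Frobenius
    relation of [T 0], transported by [alpha (- g)], forces the factor to be 1. *)
Lemma alpha_S g : alpha g S = S.
Proof.
have colinear h : exists c : R[i], alpha h S = c *: S.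
  have aS y : alpha h S * y = rho (rho y) * alpha h S.
    rewrite -{1}(alphaNK h y) -(homM (alpha_hom h)) Srho.
    by rewrite (homM (alpha_hom h)) alpha_rho2 alphaNK.
  have [|c cE] := @summand_irr None (S^* * alpha h S).
    by move=> y; rewrite -mulrA aS mulrA star_S_rho mulrA.
  exists c; rewrite -[LHS]mul1r -component_sum mulr_suml (bigD1 None) //=.
  rewrite -mulrA cE -scalerAr mulr1 big1 ?addr0 // => -[h'|] // _.
  rewrite -mulrA (@summand_schur None (Some h') ((T h')^* * alpha h S)) ?mulr0
    //.
  by move=> y; rewrite -mulrA aS mulrA (star_component_rho (Some h')) -mulrA.
have [c cE] := colinear g; rewrite cE.
have := congr1 (alpha (- g)) (T_frobenius 0).
rewrite (homM (alpha_hom _)) (homZ (alpha_hom _)) (hom_star (alpha_hom _)).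
rewrite (hd_T0 hdata) alpha_rho opprK cE (homZ rho_hom) -scalerAr T_frobenius.
rewrite scalerA => /eqP; rewrite -subr_eq0 -scalerBl scaler_eq0.
rewrite (negPf (T_neq0 _)) orbF -[X in _ - X]mul1r -mulrBl mulf_eq0.
by rewrite invr_eq0 (negPf k_neq0) orbF subr_eq0 => /eqP ->; rewrite scale1r.
Qed.

Lemma rho_S : rho S = D^-1 *: S + k^-1 *: \sum_g T g * T g.
Proof.
rewrite -[LHS]mul1r -component_sum mulr_suml big_option -mulrA star_S_rhoS
  -scalerAr.
rewrite mulr1 scaler_sumr; congr (_ + _); apply: eq_bigr => g _.
by rewrite -mulrA T_frobenius scalerAr.
Qed.

Lemma star_S_alpha_rhoT g : S^* * alpha g (rho (T g)) = (Num.conj (eta g) / k)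
  *: (T g)^*.
Proof.
rewrite (hd_A hdata) !mulrDr -!scalerAr !mulrA star_S_T star_S_S !mul0r mul1r
  scaler0.
rewrite add0r mulr_sumr big1 ?addr0 // => h _; rewrite mulr_sumr big1 // => h'
  _.
by rewrite -scalerAr !mulrA star_S_T !mul0r scaler0.
Qed.

Lemma alpha_rho_star_T_S g : alpha g (rho (T g)^*) * S = (eta g / k) *: T g.
Proof.
apply: (can_inj starK); rewrite starM starZ (hom_star rho_hom).
rewrite (hom_star (alpha_hom g)) starK star_S_alpha_rhoT rmorphM fmorphV /=
  real_conj.
done.
Qed.

Lemma alpha_rhoT_S g : alpha g (rho (T g)) * S = eta g *: (T g * S).
Proof.
rewrite (hd_A hdata) !mulrDl -!scalerAl (mul_ctx star_S_S) (mul_ctx (star_T_S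
  _)) mulr1 mulr0.
rewrite scaler0 addr0 mulr_suml big1 ?addr0 // => h _; rewrite mulr_suml.
by rewrite big1 // => h' _; rewrite -scalerAl (mul_ctx (star_T_S _)) mulr0
  scaler0.
Qed.

(** The square of [alpha g \o rho] is [rho \o rho]. Applying it once more to [star_S_alpha_rhoT] and
    multiplying by [S] compares two multiples of [T g]. *)
Lemma eta_norm g : Num.conj (eta g) * eta g = 1.
Proof.
have := congr1 (fun x => alpha g (rho x) * S) (star_S_alpha_rhoT g).
rewrite (homZ rho_hom) (homZ (alpha_hom g)) -scalerAl alpha_rho_star_T_S
  scalerA.
rewrite rM (homM (alpha_hom g)) !alpha_rho ?(hom_star (alpha_hom _)) alpha_S.
rewrite opprK alphaNK -mulrA -Srho mulrA rho_star_S_S -scalerAl mul1r.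
move/eqP; rewrite -subr_eq0 -scalerBl scaler_eq0 (negPf (T_neq0 g)) orbF.
rewrite mulrACA -invfM sqrt_d_sqr -[X in X - _]mul1r -mulrBl mulf_eq0 invr_eq0.
by rewrite (negPf D_neq0) orbF subr_eq0 => /eqP <-.
Qed.

Lemma rho_star_T_S g : rho (T g)^* * S = (eta g / k) *: alpha (- g) (T g).
Proof.
have := congr1 (alpha (- g)) (alpha_rho_star_T_S g).
by rewrite (homM (alpha_hom _)) alphaKN alpha_S (homZ (alpha_hom _)).
Qed.

(** One factor [eta g] comes from [rho_star_T_S] and two from [alpha_rhoT_S], used before and after
    moving [T g] to the left. *)
Lemma range_rotation g : rho (rho (T g * (T g)^*)) * rho S * S =
  eta g ^+ 3 *: (T g * (T g)^* * rho S * S).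
Proof.
rewrite !rM -!(mulrA _ _ (rho S)) -rM rho_star_T_S (homZ rho_hom) T_frobenius.
have -> : rho (alpha (- g) (T g)) = alpha g (rho (T g)) by rewrite alpha_rho.
rewrite -!scalerAr -!scalerAl -mulrA alpha_rhoT_S -scalerAr mulrA -Trho.
rewrite -(mulrA (T g)) alpha_rhoT_S -!scalerAr !scalerA -!mulrA; congr (_ *: _).
by ring.
Qed.

(* The rotation by pi maps the projection [T g (T g)^*] to a multiple of
   itself; being antimultiplicative it can only fix it. *)
Lemma eta_cube g : eta g ^+ 3 = 1.
Proof.
set P := T g * (T g)^*; set s := rho S * S.
have rotP : rho (rho P) * s = eta g ^+ 3 *: (P * s).
  by rewrite /s mulrA range_rotation !mulrA.
have PP : P * P = P by rewrite /P mulrA -(mulrA (T g)) T_isometry mulr1.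
have P_rho y : P * rho (rho y) = rho (rho y) * P.
  by rewrite /P -mulrA (star_component_rho (Some g)) mulrA Trho mulrA.
have Ps_neq0 : P * s != 0.
  rewrite /P /s mulrA -(mulrA (T g)) T_frobenius -scalerAr -scalerAl.
  rewrite scaler_eq0 invr_eq0 (negPf k_neq0) /=.
  apply: contraPneq (star_S_S) => /(congr1 (fun x => S^* * ((T g)^* * ((T g)^*
    * x)))).
  rewrite !mulr0 -!mulrA (mulrA (T g)^* (T g)) T_isometry mul1r.
  rewrite (mulrA (T g)^* (T g)) T_isometry mul1r => -> /esym/eqP.
  by rewrite oner_eq0.
have eta_neq0 : eta g ^+ 3 != 0.
  rewrite expf_eq0 /=; apply: contraPneq (eta_norm g) => ->.
  by rewrite mulr0 => /esym/eqP; rewrite oner_eq0.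
(* Computed in two ways, the rotation of [P * P = P] gives the factor [eta g ^+ 3] and also its
   square. *)
have : rho (rho (P * P)) * s = eta g ^+ 3 *: (rho (rho P) * P * s).
  by rewrite (rM P) (rM (rho P)) -mulrA rotP -scalerAr mulrA.
rewrite PP -P_rho -mulrA rotP -scalerAr (mulrA P P) PP scalerA => /eqP.
rewrite -subr_eq0 -scalerBl scaler_eq0 (negPf Ps_neq0) orbF.
rewrite -[X in X - _]mulr1 -mulrBr mulf_eq0 (negPf eta_neq0) subr_eq0.
by move/eqP.
Qed.

Lemma rho_rho2 x : (forall y, x * rho y = rho (rho y) * x) ->
  exists a : R[i], x = a *: T 0.
Proof.
move=> xr; have [y|a aE] := @summand_irr (Some 0) ((T 0)^* * x).
  by rewrite /= alpha0 -mulrA xr mulrA (star_component_rho (Some 0)) /= alpha0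
    mulrA.
exists a; rewrite -[LHS]mul1r -component_sum mulr_suml (bigD1 (Some 0)) //=.
rewrite -mulrA aE -scalerAr mulr1 big1 ?addr0 // => o o0.
rewrite -mulrA (@summand_schur (Some 0) o ((component o)^* * x)) ?mulr0
  1?eq_sym //.
by move=> y; rewrite /= alpha0 -mulrA xr mulrA star_component_rho -mulrA.
Qed.

(** By Schur's lemma [x] is diagonal in the component projections, and each of these is fixed: those
    of [T g] by [eta_cube], that of [S] by direct computation. *)
Lemma rho2_sym x : (forall y, x * rho (rho y) = rho (rho y) * x) ->
  x * rho S * S = rho (rho x) * rho S * S.
Proof.
move=> xr.
have [c xE] : exists c : option G -> R[i],
    x = \sum_o c o *: (component o * (component o)^*).
  have /choice[c cE] : forall o, exists c : R[i], (component o)^* * x *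
    component o = c *: 1.
    move=> o; apply: (@summand_irr o) => y.
    by rewrite -mulrA component_rho -!mulrA (mulrA x) xr !mulrA
      star_component_rho.
  exists c; rewrite -[LHS]mul1r -component_sum mulr_suml.
  apply: eq_bigr => o _.
  rewrite -[LHS]mulr1 -component_sum mulr_sumr (bigD1 o) //= big1 ?addr0.
    by rewrite mulrA -2!(mulrA (component o)) cE -scalerAr -scalerAl mulr1.
  move=> o' o'o; rewrite mulrA -2!(mulrA (component o)).
  rewrite (@summand_schur o' o ((component o)^* * x * component o')) ?mulr0
    ?mul0r //.
  by move=> y; rewrite -mulrA component_rho -!mulrA (mulrA x) xr !mulrA
    star_component_rho.
rewrite xE !(hom_sum rho_hom) !mulr_suml; apply: eq_bigr => o _.
rewrite !(homZ rho_hom) -!scalerAl; congr (_ *: _); case: o => [g|] /=.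
  by rewrite range_rotation eta_cube scale1r.
rewrite -(mulrA S) star_S_rhoS !rM -(mulrA _ _ (rho S)) -rM rho_star_S_S.
rewrite (homZ rho_hom) (hom1 rho_hom) -!scalerAr -!scalerAl !mulr1.
by rewrite -Srho.
Qed.

Hypothesis hA : forall h, A 0 h 0 = (h == 0)%:R - ((d - 1)^-1)%:C.

Lemma rho_star_S_T g : rho S^* * T g = k^-1 *: (T g)^*.
Proof.
apply: (can_inj starK); rewrite starM starZ !starK (hom_star rho_hom) starK.
by rewrite T_frobenius fmorphV /= real_conj.
Qed.

Lemma rho_T0 : rho (T 0) = eta 0 *: (T 0 * S * S^*)
  + (Num.conj (eta 0) / k) *: (S * (T 0)^*)
  + \sum_h \sum_h' A 0 h h' *: (T h * T (h + h') * (T h')^*).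
Proof.
have := hd_A hdata 0; rewrite alpha0 => ->; congr (_ + _).
by apply: eq_bigr => h _; apply: eq_bigr => h' _; rewrite !add0r.
Qed.

Lemma star_T_star_T_rhoT0 g : (T g)^* * ((T g)^* * rho (T 0)) = A 0 g 0 *: (T
  0)^*.
Proof.
have TsTK h x : (T h)^* * (T h * x) = x by rewrite mulrA T_isometry mul1r.
have TsTN h h' x : h != h' -> (T h)^* * (T h' * x) = 0.
  by move=> hh'; rewrite mulrA star_T_T (negPf hh') mul0r.
rewrite rho_T0 !mulrDr -!scalerAr -!mulrA (mulrA (T g)^* S) star_T_S mul0r.
rewrite mulr0 scaler0 addr0.
(* For [g = 0] the first factor cancels, but [T 0] is still orthogonal to [S]. *)
have -> : (T g)^* * ((T g)^* * (T 0 * (S * S^*))) = 0.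
  have [<-|g0] := eqVneq g 0; last by rewrite TsTN // mulr0.
  by rewrite TsTK mulrA star_T_S mul0r.
rewrite scaler0 add0r !mulr_sumr (bigD1 g) //= addrC big1 => [|h hg]; last
  first.
  rewrite !mulr_sumr big1 // => h' _.
  by rewrite -!scalerAr -!mulrA TsTN ?mulr0 ?scaler0 // eq_sym.
rewrite add0r !mulr_sumr (bigD1 0) //= addrC big1 => [|h' h'0]; last first.
  rewrite -!scalerAr -!mulrA TsTK TsTN ?scaler0 //.
  by rewrite -[X in X == _]addr0 (inj_eq (addrI g)) eq_sym.
by rewrite add0r -!scalerAr -!mulrA TsTK addr0 TsTK.
Qed.

(** Apply [rho] to the orthogonality of [T 0] and [S], then expand [rho S]. The hypothesis [hA]
    evaluates the sum of the [A 0 g 0], and [d_quadratic] solves for [eta 0]. *)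
Lemma eta0 : eta 0 = 1.
Proof.
have : rho (T 0)^* * rho S = 0 by rewrite -rM star_T_S (hom0 rho_hom).
rewrite rho_S mulrDr -!scalerAr rho_star_T_S oppr0 alpha0 mulr_sumr.
have E g : rho (T 0)^* * (T g * T g) = Num.conj (A 0 g 0) *: T 0.
  apply: (can_inj starK); rewrite !starM starZ (hom_star rho_hom) starK.
  by rewrite -mulrA star_T_star_T_rhoT0 conjCK.
rewrite (eq_bigr _ (fun g _ => E g)) -scaler_suml !scalerA -scalerDl => /eqP.
rewrite scaler_eq0 (negPf (T_neq0 0)) orbF.
have -> : \sum_g Num.conj (A 0 g 0) = 1 - #|G|%:R / (D - 1).
  rewrite (eq_bigr (fun g => (g == 0)%:R - (D - 1)^-1)) => [|g _]; last first.
    by rewrite hA rmorphB rmorph_nat /= real_conj fmorphV rmorphB.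
  rewrite sumrB sumr_const (bigD1 0) //= eqxx big1 => [|g /negPf -> //].
  by rewrite addr0 mulr_natl.
move=> /eqP /(congr1 (fun x => D * k * (D - 1) * x)); rewrite mulr0.
have -> : D * k * (D - 1) * (D^-1 * (eta 0 / k) + k^-1 * (1 - #|G|%:R / (D -
  1)))
    = (D - 1) * eta 0 + D * (D - 1) - D * #|G|%:R.
  by field; rewrite D_neq0 k_neq0 D1_neq0.
have -> : (D - 1) * eta 0 + D * (D - 1) - D * #|G|%:R = (D - 1) * (eta 0 - 1).
  have DD : D ^+ 2 = 1 + #|G|%:R * D.
    by rewrite -rmorphXn d_quadratic rmorphD rmorphM rmorph1 rmorph_nat.
  transitivity ((D - 1) * eta 0 + (D ^+ 2 - #|G|%:R * D) - D); first by ring.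
  by rewrite DD; ring.
by move/eqP; rewrite mulf_eq0 (negPf D1_neq0) subr_eq0 => /eqP.
Qed.

(** Multiplication by [T 0] on the right kills every term with [h' != 0], so only the coefficients
    given by [hA] remain. *)
Lemma rhoT0_T0 : rho (T 0) * T 0 =
  T 0 * T 0 + k^-1 *: S - (D - 1)^-1 *: \sum_g T g * T g.
Proof.
rewrite rho_T0 eta0 rmorph1 !mulrDl -!scalerAl -!(mulrA _ _ (T 0)) star_S_T
  T_isometry.
rewrite mulr0 scaler0 add0r mulr1 mul1r addrC addrAC; congr (_ + _).
have E h : (\sum_h' A 0 h h' *: (T h * T (h + h') * (T h')^*)) * T 0 =
    (h == 0)%:R *: (T h * T h) - (D - 1)^-1 *: (T h * T h).
  rewrite mulr_suml (bigD1 0) //= big1 => [|h' h'0].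
    rewrite !addr0 -scalerAl (mul_ctx (T_isometry 0)) mulr1 hA scalerBl.
    by rewrite fmorphV rmorphB.
  by rewrite -scalerAl (mul_ctx (star_T_T _ _)) (negPf h'0) mulr0 scaler0.
rewrite mulr_suml (eq_bigr _ (fun h _ => E h)) sumrB -scaler_sumr.
rewrite (bigD1 0) //= eqxx scale1r big1 ?addr0 // => h /negPf ->.
by rewrite scale0r.
Qed.
(** The coefficients make the sums of the [T g * T g] cancel; the [S] terms agree because
    [k * k = D]. This is the part of the Q-system's associativity that depends on the category. *)
Lemma T0_associativity : k *: rho S + (D - 1) *: (rho (T 0) * T 0) =
  k *: S + (D - 1) *: (T 0 * T 0).
Proof.
rewrite rhoT0_T0 rho_S scalerBr !scalerDr !scalerA !divff ?k_neq0 ?D1_neq0 //.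
rewrite !scale1r addrACA subrr addr0 [X in _ + X]addrC addrA -scalerDl.
congr (_ *: _ + _); rewrite -sqrt_d_sqr; field; exact: k_neq0.
Qed.
End HaagerupData.

(** * The Q-system of the subfactor *)

Section QSystem.
Context {R : rcfType} {M : starAlgType R}.
Variables (rho gamma : M -> M) (V0 V1 W S T : M) (k m : R[i]).
Hypotheses (hrho : unital_hom setT setT rho)
  (V00 : V0^* * V0 = 1) (V11 : V1^* * V1 = 1)
  (VV : V0 * V0^* + V1 * V1^* = 1)
  (gammaE : forall y, gamma y = V0 * y * V0^* + V1 * rho y * V1^*)
  (Srho : forall y, S * y = rho (rho y) * S)
  (Trho : forall y, T * rho y = rho (rho y) * T)
  (rTS : rho T * S = T * S)
  (rSsS : (k * k) *: (rho S^* * S) = 1) (rSsT : k *: (rho S^* * T) = T^*)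
  (k_conj : Num.conj k = k) (m_conj : Num.conj m = m)
  (kS_mTT : k *: rho S + (m * m) *: (rho T * T) = k *: S + (m * m) *: (T * T))
  (* the isometry of the Q-system times sqrt(d + 1), so that V0^* W = 1 *)
  (WE : W = V0 + V1 * rho V0 * V1^* + k *: (V1 * rho V1 * S * V0^*)
            + m *: (V1 * rho V1 * T * V1^*)).

(** The blocks of [W]: one has [V0^* * W = 1], [V1^* * W = Y], [rho V0^* * Y = V1^*] and
    [rho V1^* * Y = U]. *)
Let Y := rho V0 * V1^* + k *: (rho V1 * S * V0^*) + m *: (rho V1 * T * V1^*).
Let U := k *: (S * V0^*) + m *: (T * V1^*).

Local Notation rM := (homM hrho).
Local Notation gM := (homM (gamma_hom hrho V00 V11 VV gammaE)).
Let v01 := V0s_V1 V00 V11 VV.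
Let v10 := V1s_V0 V00 V11 VV.
Let gV0 := gammaV0 V00 V11 VV gammaE.
Let gV1 := gammaV1 V00 V11 VV gammaE.
Let V0sg := V0sgamma V00 V11 VV gammaE.
Let V1sg := V1sgamma V00 V11 VV gammaE.

Lemma qsystem_unitl : V0^* * W = 1.
Proof.
by rewrite WE !mulrDr -!scalerAr !mulrA V00 v01 !mul0r !scaler0 !addr0.
Qed.

Lemma qsystem_V1 : V1^* * W = Y.
Proof.
by rewrite WE !mulrDr -!scalerAr !mulrA V11 v10 add0r !mul1r.
Qed.

Lemma qsystem_V0 : W * V0 = V0 * V0 + k *: (V1 * rho V1 * S).
Proof.
rewrite WE !mulrDl -!scalerAl !(mul_ctx V00) !(mul_ctx v10) !mulr0 scaler0.
by rewrite !addr0 mulr1.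
Qed.

Lemma rhoV0_Y : rho V0^* * Y = V1^*.
Proof.
rewrite /Y !mulrDr -!scalerAr !mulrA -!rM V00 v01 (hom1 hrho) (hom0 hrho).
by rewrite !mul0r !scaler0 !addr0 mul1r.
Qed.

Lemma rhoV1_Y : rho V1^* * Y = U.
Proof.
rewrite /Y !mulrDr -!scalerAr !mulrA -!rM V11 v10 (hom1 hrho) (hom0 hrho).
by rewrite !mul0r add0r !mul1r.
Qed.

Lemma qsystem_unitr : gamma V0^* * W = 1.
Proof.
rewrite WE !mulrDr -!scalerAr !mulrA gV0 gV1 -!(mulrA V1) -!rM V00 v01.
by rewrite (hom1 hrho) (hom0 hrho) !(mulr0, mul0r) mul1r !scaler0 !addr0.
Qed.

Lemma qsystem_intertwine y : W * gamma y = gamma (gamma y) * W.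
Proof.
rewrite WE !(mulrDl, mulrDr) -!(scalerAl, scalerAr) !mulrA !gV0 !gV1.
rewrite !(mul_ctx (V0sg _)) !(mul_ctx (V1sg _)) !mulrA.
have E0 z : z * rho (gamma y) * rho V0 = z * rho V0 * rho y.
  by rewrite -!mulrA -!rM gV0.
have E1 z : z * rho (gamma y) * rho V1 = z * rho V1 * rho (rho y).
  by rewrite -!mulrA -!rM gV1.
by rewrite !E0 !E1 (mul_ctx2 (Trho _)) (mul_ctx2 (Srho _)).
Qed.

Lemma V_ext (a b : M) : V0^* * a = V0^* * b -> V1^* * a = V1^* * b -> a = b.
Proof.
by move=> E0 E1; rewrite -[a]mul1r -[b]mul1r -VV !mulrDl -!mulrA E0 E1.
Qed.

Lemma rhoV_ext (a b : M) : rho V0^* * a = rho V0^* * b ->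
  rho V1^* * a = rho V1^* * b -> a = b.
Proof.
move=> E0 E1; rewrite -[a]mul1r -[b]mul1r -(hom1 hrho) -VV (homD hrho) !rM.
by rewrite !mulrDl -!mulrA E0 E1.
Qed.

Lemma rhoY_Y : rho Y * Y = k *: S + m *: (T * Y).
Proof.
(* The hypothesis [kS_mTT] is placed between [rho (rho V1)] and [V1^*]; all other terms match
   formally. *)
have key : k *: (rho (rho V1) * rho S * V1^*)
    + (m * m) *: (rho (rho V1) * rho T * T * V1^*)
    = k *: (S * V1 * V1^*) + (m * m) *: (T * rho V1 * T * V1^*).
  have := congr1 (fun z => rho (rho V1) * z * V1^*) kS_mTT.
  rewrite !(mulrDr, mulrDl) -!(scalerAl, scalerAr) !mulrA.
  by rewrite -Srho -Trho.
have -> : rho Y = rho (rho V0) * rho V1^* + k *: (rho (rho V1) * rho S * rho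
  V0^*)
    + m *: (rho (rho V1) * rho T * rho V1^*).
  by rewrite !(homD hrho, homZ hrho) !rM.
rewrite !mulrDl -!scalerAl -!(mulrA _ _ Y) rhoV0_Y rhoV1_Y.
rewrite /U !mulrDr -!scalerAr !mulrA -Srho -Trho.
rewrite -(mulrA _ (rho T) S) rTS mulrA -Trho !scalerDr !scalerA.
rewrite [_ *: _ + (m * m) *: _]addrC -addrA [k *: (_ * V1^*) + _]addrA key.
have -> : k *: S = k *: (S * V0 * V0^*) + k *: (S * V1 * V1^*).
  by rewrite -scalerDr -!mulrA -mulrDr VV mulr1.
rewrite -!addrA; congr (_ + _); rewrite [LHS]addrCA; congr (_ + _).
by congr (_ + _); rewrite addrC.
Qed.

(** Tested block by block. The blocks for [V0^*] and [rho V0^*] are unit laws, and the remaining one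
    is [rhoY_Y]. *)
Lemma qsystem_assoc : W * W = gamma W * W.
Proof.
apply: V_ext; first by rewrite !mulrA qsystem_unitl V0sg mul1r -mulrA
  qsystem_unitl mulr1.
rewrite !mulrA qsystem_V1 V1sg -(mulrA _ V1^*) qsystem_V1; apply: rhoV_ext.
  by rewrite !mulrA rhoV0_Y -rM qsystem_unitl (hom1 hrho) mul1r qsystem_V1.
rewrite !mulrA rhoV1_Y -rM qsystem_V1 rhoY_Y /U mulrDl -!scalerAl -!mulrA.
by rewrite qsystem_unitl qsystem_V1 mulr1.
Qed.

(** The element [W * V0] of (id, gamma^2) bends a leg of [W], and the result is its adjoint; the
    scalars match by [rSsS] and [rSsT]. *)
Lemma qsystem_rotate : gamma (W * V0)^* * W = W^*.
Proof.
apply: V_ext; first by rewrite mulrA V0sg -mulrA qsystem_unitl mulr1 starM.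
rewrite mulrA V1sg -mulrA qsystem_V1 qsystem_V0.
have -> : V1^* * W^* = V1^* * V0^* + rho V0^* * V1^* + m *: (T^* * rho V1^* *
  V1^*).
  rewrite -starM WE !mulrDl -!scalerAl (mul_ctx v01) !(mul_ctx V11) mulr0.
  rewrite scaler0 addr0 !mulr1 !starD starZ m_conj !starM.
  by rewrite -!(hom_star hrho) !mulrA.
rewrite starD starZ k_conj !starM -(hom_star hrho) !mulrA.
rewrite (homD hrho) (homZ hrho) !rM mulrDl -scalerAl -!(mulrA _ _ Y).
rewrite rhoV0_Y rhoV1_Y /U mulrDr -!scalerAr !mulrA.
rewrite (mul_ctx2 (esym (Srho _))) (mul_ctx2 (esym (Trho _))) scalerDr !scalerA.
rewrite [k * m]mulrC -(scalerA m) 2!(scalerAl k) 2!(scalerAl (k * k)) rSsS rSsT.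
by rewrite mul1r addrA; congr (_ + _); rewrite addrC.
Qed.

(** Writing [W^*] as a bent [W] by [qsystem_rotate] reduces this to associativity. *)
Lemma qsystem_frobenius : W * W^* = gamma W^* * W.
Proof.
rewrite -{2}qsystem_rotate gM -mulrA -qsystem_assoc mulrA -qsystem_intertwine
  -mulrA.
by rewrite qsystem_rotate.
Qed.

End QSystem.

(** * Multiplicities for the $3^G$ subfactor *)

Lemma qsystem_subalgebraZ {R : realType} {M : starAlgType R} (gamma : M -> M)
  (W W' : M)
  (c : R[i]) : c != 0 -> W = c *: W' ->
  qsystem_subalgebra gamma W = subalg gamma W'.
Proof.
move=> c0 ->; have cE x : ((c *: W') * x = gamma x * (c *: W')) =
    (W' * x = gamma x * W').
  rewrite propeqE -scalerAl -scalerAr.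
  by split=> [/(scalerI c0)|->].
by rewrite /qsystem_subalgebra /subalg; apply/seteqP; split=> x /=; rewrite !cE.
Qed.

Theorem theorem7p5 (R : realType) (M : starAlgType R) (G : finZmodType)
    (hM : hyperfinite_III1_factor M)
    (* the category and its numerical data *)
    (C : set (M -> M)) (rho : M -> M) (alpha : G -> M -> M)
    (hC : generalized_haagerup C rho alpha)
    (S : M) (T : G -> M)
    (eps : G -> G -> R[i]) (eta : G -> R[i]) (A : G -> G -> G -> R[i])
    (hdata : haagerup_data rho alpha S T eps eta A)
    (hA : forall h : G,
       A 0 h 0 = (h == 0)%:R - ((haagerup_dim R G - 1)^-1)%:C)
    (* the 3^G subfactor N of M *)
    (V0 V1 : M)
    (hV0 : fixed_points alpha V0 /\ is_isometry V0)
    (hV1 : fixed_points alpha V1 /\ is_isometry V1)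
    (hV : V0 * star V0 + V1 * star V1 = 1)
    (gamma : M -> M) (hgamma : gamma = qsystem_hom rho V0 V1)
    (W : M) (hW : W = qsystem_isometry (G := G) rho S (T 0) V0 V1)
    (N : set M) (hN : N = qsystem_subalgebra gamma W)
    (* kappa : N -> M with [rho iota] = [iota] + [kappa] *)
    (kappa : M -> M) (hkappa : irreducible N setT kappa)
    (hkappa_sum : direct_sum2 N setT rho id kappa)
    (* rhohat in End(N) with [iotabar iota] = [id] + [rhohat] *)
    (rhohat : M -> M) (hrhohat : irreducible N N rhohat)
    (hrhohat_sum : direct_sum2 N N gamma id rhohat)
    (J0 : {set G}) (hJ0 : representatives J0)
    (* the remaining irreducible components of iotabar kappa *)
    (J1 : finType) (n : J1 -> nat) (sigma : J1 -> M -> M)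
    (hn : forall j, (1 <= n j)%N)
    (hsigma : forall j, irreducible N N (sigma j))
    (hsigma_distinct : forall i j, equivalent N N (sigma i) (sigma j) -> i = j)
    (hsigma_rhohat : forall j z, two_torsion z ->
       ~ equivalent N N (sigma j) (rhohat \o alpha z))
    (hsigma_pi : forall j g, g \in J0 ->
       ~ equivalent N N (sigma j) (gamma \o alpha g))
    (hdecomp : direct_sum N N (gamma \o kappa)
       (fun i : {z : G | two_torsion z} + {g : G | g \in J0}
                + {j : J1 & 'I_(n j)} =>
          match i with
          | inl (inl z) => rhohat \o alpha (val z)
          | inl (inr g) => gamma \o alpha (val g)
          | inr jk => sigma (tag jk)
          end)) :
  forall j, n j = 1%N.
Proof.
have hrho := rho_hom hC.
have [_ V00] := hV0; have [_ V11] := hV1.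
rewrite /is_isometry in V00 V11.
have gammaE y : gamma y = V0 * y * star V0 + V1 * rho y * star V1.
  by rewrite hgamma.
have hg := gamma_hom hrho V00 V11 hV gammaE.
pose d := haagerup_dim R G; pose k : R[i] := ((Num.sqrt d)%:C).
pose m : R[i] := ((Num.sqrt (d - 1))%:C).
pose W' := V0 + V1 * rho V0 * star V1 + k *: (V1 * rho V1 * S * star V0)
            + m *: (V1 * rho V1 * T 0 * star V1).
have d1 : 1 < d := d_gt1.
have d0 : 0 < d := d_gt0.
have sqrt_d_sqr' : k * k = d%:C := sqrt_d_sqr.
have mm : m * m = d%:C - 1.
  by rewrite -rmorphM -expr2 sqr_sqrtr ?rmorphB // subr_ge0 ltW.
have k0 : k != 0 := k_neq0.
have d0' : d%:C != 0 := D_neq0.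
pose c : R[i] := ((Num.sqrt (d + 1))^-1)%:C.
have c0 : c != 0.
  by rewrite fmorph_eq0 invr_eq0 gt_eqF // sqrtr_gt0 addr_gt0.
have WE : W = c *: W'.
  rewrite hW /qsystem_isometry /W' !scalerDr !scalerA /c /k /m -!rmorphM.
  rewrite !sqrtrM ?subr_ge0 ?(ltW d0) ?(ltW d1) // !sqrtrV ?addr_ge0 ?(ltW d0)
    //.
  by rewrite ![(Num.sqrt _)^-1 * _]mulrC.
(* The equations defining [N] are homogeneous in [W], so the normalization with [V0^* W' = 1] may be
   used. *)
have {}NE : N = subalg gamma W' by rewrite hN; apply: qsystem_subalgebraZ c0 WE.
have Tr y : T 0 * rho y = rho (rho y) * T 0.
  by rewrite -(Trho hdata) (alpha0 hC).
have Sr := Srho hdata.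
have eta1 : eta 0 = 1 := eta0 hM hC hdata hA.
have rTS : rho (T 0) * S = T 0 * S.
  by have := alpha_rhoT_S hM hC hdata 0; rewrite (alpha0 hC) eta1 scale1r.
have rTsS : rho (star (T 0)) * S = k^-1 *: T 0.
  by have := alpha_rho_star_T_S hM hC hdata 0; rewrite (alpha0 hC) eta1 mul1r.
have rSsS : (k * k) *: (rho (star S) * S) = 1.
  by rewrite (rho_star_S_S hC hdata) sqrt_d_sqr' scalerA divff // scale1r.
have rSsT : k *: (rho (star S) * T 0) = star (T 0).
  by rewrite (rho_star_S_T hC hdata) scalerA divff // scale1r.
have key : k *: rho S + (m * m) *: (rho (T 0) * T 0) =
    k *: S + (m * m) *: (T 0 * T 0).
  by rewrite mm; apply: (T0_associativity hM hC hdata hA).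
have W'E : W' = W' by [].
have kc : Num.conj k = k by apply: real_conj.
have mc : Num.conj m = m by apply: real_conj.
have VW := qsystem_unitl V00 V11 hV W'E.
have gVW := qsystem_unitr hrho V00 V11 hV gammaE W'E.
have Wg := qsystem_intertwine hrho V00 V11 hV gammaE Sr Tr W'E.
have WW := qsystem_assoc hrho V00 V11 hV gammaE Sr Tr rTS key W'E.
have WWs := qsystem_frobenius hrho V00 V11 hV gammaE Sr Tr rTS rSsS rSsT kc mc
  key W'E.
have WV0 := qsystem_V0 V00 V11 hV W'E.
move=> j; apply/eqP; rewrite eqn_leq hn andbT leqNgt; apply/negP => n2.
have [X [_ XX Xsum rhoE]] := hkappa_sum.
have [V [NV VV Vsum gkE]] := hdecomp.
(* If [n j] were at least 2, the indices 0 and 1 would label two copies of [sigma j]. *)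
pose o (b : bool) : 'I_(n j) :=
  if b then Ordinal n2 else Ordinal (hn j).
pose i (b : bool) : {z : G | two_torsion z} + {g : G | g \in J0}
                + {j : J1 & 'I_(n j)} := inr (Tagged (fun j => 'I_(n j)) (o b)).
have i_inj : injective i.
  have tag_inj : injective (fun b => Tagged (fun j => 'I_(n j)) (o b)).
    by move=> b b' /eqP; rewrite eq_Tagged; case: b b' => [] [].
  by move=> b b' [] /tag_inj.
(* [X true] embeds kappa into rho iota, so [w b] embeds a copy of [sigma j] into iotabar rho iota
   through iotabar kappa. *)
pose w b := gamma (X true) * V (i b).
have gX b b' : star (gamma (X b)) * gamma (X b') = (b == b')%:R.
  rewrite -(hom_star hg) -(homM hg) XX.
  by case: eqP => _; [apply: hom1|apply: hom0].
have Vg b y : N y -> star (V (i b)) * gamma (kappa y) = sigma j y * star (V (i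
  b)).
  move=> Ny; rewrite -[gamma _]/((gamma \o kappa) y) gkE // mulr_sumr.
  rewrite (bigD1 (i b)) //= !mulrA VV eqxx mul1r big1 ?addr0 // => i' i'b.
  by rewrite !mulrA VV eq_sym (negPf i'b) !mul0r.
have gV b y : N y -> gamma (kappa y) * V (i b) = V (i b) * sigma j y.
  move=> Ny; rewrite -[gamma _]/((gamma \o kappa) y) gkE // mulr_suml.
  rewrite (bigD1 (i b)) //= -!mulrA VV eqxx mulr1 big1 ?addr0 // => i' i'b.
  by rewrite -!mulrA VV (negPf i'b) !mulr0.
have Xr y : N y -> star (X true) * rho y = kappa y * star (X true).
  move=> Ny; rewrite rhoE // mulr_sumr (bigD1 true) //= !mulrA XX eqxx mul1r.
  by rewrite big1 ?addr0 // => b b1; rewrite !mulrA XX eq_sym (negPf b1) !mul0r.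
have rX y : N y -> rho y * X true = X true * kappa y.
  move=> Ny; rewrite rhoE // mulr_suml (bigD1 true) //= -!mulrA XX eqxx mulr1.
  by rewrite big1 ?addr0 // => b b1; rewrite -!mulrA XX (negPf b1) !mulr0.
(* [X false] embeds iota into rho iota, so [gamma (X false)] marks the copy of iotabar iota, which
   is orthogonal to both [w b]. *)
apply: (multiplicity_free hrho V00 V11 hV gammaE WV0 k0 Sr Tr (T_isometry hdata
  0)
  rTS (T_frobenius hdata 0) rTsS (rho_irr hC) (rho_rho2 hM hC hdata)
  (rho2_sym hM hC hdata) Wg VW gVW WW WWs (star_S_rhoS hC hdata) _
  (w := w) (X := X false)).
- by rewrite invr_eq0.
- move=> b b'; rewrite /w starM mulrA -(mulrA (star (V _))) gX mulr1 VV.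
  by rewrite (inj_eq i_inj).
- move=> b b'; have NVi b'' : subalg gamma W' (V (i b'')) by rewrite -NE.
  have NX y : subalg gamma W' (gamma y) by apply: subalg_gamma.
  split; rewrite /w starM -(hom_star hg).
    apply: (subalgM hg); first exact: (subalgM hg).
    apply: (subalgM hg) => //.
    by have [? ?] := NVi b'; split; rewrite ?starK.
  move=> y; rewrite -NE => Ny.
  rewrite -(mulrA (_ * V _)) -(mulrA (star _)) -(homM hg) (hom_star hg).
  rewrite Xr // (homM hg) (hom_star hg) !mulrA (mul_ctx2 (Vg b' y Ny)).
  by rewrite -(homM hg (rho y)) rX // (homM hg _ (kappa y)) (mul_ctx2 (gV b y
    Ny)).
- move=> b; rewrite /w starM -mulrA gX /= mulr0 //.
- by rewrite XX.
Qed.
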